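(* The Feedback Arc Set problem (FAS) is (polynomial-time many-one) reducible to the Acyclic Hamiltonian Partition problem (AHP).
   Context: All graphs are finite directed graphs. A feedback arc set of a digraph $G=\langle V,E\rangle$ is a subset $E'\subseteq E$ containing at least one arc of every directed cycle of $G$. FAS: Instance: a directed graph $G=\langle V,E\rangle$ and a positive integer $K\le|V|$. Question: is there a feedback arc set of $G$ of size at most $K$? For a digraph $G=\langle V,E\rangle$ and $V_1\subseteq V$, $G[V_1]$ is the induced subgraph. A partition $\pi=\{V_1,\dots,V_k\}$ of $V$ is an $\mathcal{H}^k$-partition if each $G[V_i]$ has a directed Hamiltonian path. The quotient digraph $G/\pi$ has vertex set $\pi$ and an arc $\langle V_i,V_j\rangle$ ($i\ne j$) whenever some arc of $E$ goes from $V_i$ to $V_j$. An $\mathcal{H}^{(\ast)}$-partition is an $\mathcal{H}^k$-partition (for some $k$) whose quotient digraph $G/\pi$ is acyclic. AHP: Instance: a DAG $G=\langle V,E\rangle$ and a positive integer $K\le|V|$. Question: is there an $\mathcal{H}^{(\ast)}$-partition of $G$ of size at most $K$? *)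

(* Defs.v *)
From mathcomp Require Import all_boot.

Set Implicit Arguments.
Unset Strict Implicit.
Unset Printing Implicit Defensive.

Record instance := Inst {
  inst_n : nat;
  inst_arcs : {set 'I_inst_n * 'I_inst_n};
  inst_K : nat
}.

Definition arc_rel (n : nat) (E : {set 'I_n * 'I_n}) : rel 'I_n :=
  fun x y => (x, y) \in E.

Definition is_dcycle (T : eqType) (r : rel T) (c : seq T) : bool :=
  [&& c != [::], uniq c & cycle r c].

Definition cycle_arcs (T : eqType) (c : seq T) : seq (T * T) :=
  [seq (x, next c x) | x <- c].

Definition acyclic (T : eqType) (r : rel T) : Prop :=
  forall c : seq T, ~~ is_dcycle r c.

Definition feedback_arc_set (n : nat) (E F : {set 'I_n * 'I_n}) : Prop :=
  F \subset E /\
  forall c : seq 'I_n, is_dcycle (arc_rel E) c -> has (mem F) (cycle_arcs c).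

Definition FAS_instance (I : instance) : Prop :=
  0 < inst_K I <= inst_n I.

Definition FAS_yes (I : instance) : Prop :=
  exists F : {set 'I_(inst_n I) * 'I_(inst_n I)},
    feedback_arc_set (inst_arcs I) F /\ #|F| <= inst_K I.

Definition has_ham_path (n : nat) (E : {set 'I_n * 'I_n}) (B : {set 'I_n}) : Prop :=
  exists s : seq 'I_n,
    [/\ s != [::], uniq s, [set x in s] = B & sorted (arc_rel E) s].

Definition quot_rel (n : nat) (E : {set 'I_n * 'I_n}) (P : {set {set 'I_n}})
  : rel {set 'I_n} :=
  fun A B => [&& A \in P, B \in P, A != B &
                 [exists x in A, exists y in B, (x, y) \in E]].

Definition Hstar_partition (n : nat) (E : {set 'I_n * 'I_n})
  (P : {set {set 'I_n}}) : Prop :=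
  [/\ partition P [set: 'I_n],
      (forall B, B \in P -> has_ham_path E B) &
      acyclic (quot_rel E P)].

Definition AHP_instance (I : instance) : Prop :=
  acyclic (arc_rel (inst_arcs I)) /\ 0 < inst_K I <= inst_n I.

Definition AHP_yes (I : instance) : Prop :=
  exists P : {set {set 'I_(inst_n I)}},
    Hstar_partition (inst_arcs I) P /\ #|P| <= inst_K I.

Definition encode (I : instance) : seq bool :=
  nseq (inst_n I) true ++ false ::
  [seq (x, y) \in inst_arcs I | x <- enum 'I_(inst_n I), y <- enum 'I_(inst_n I)]
  ++ nseq (inst_K I) true.

Inductive move := MoveL | MoveR | MoveS.

(* States 'I_q.+1 (start state 0); tape symbols 'I_s.+3 with 0 = blank, *)
(* 1 = bit false, 2 = bit true.  delta = None means "halt".            *)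
Record TM := MkTM {
  tm_q : nat;
  tm_s : nat;
  tm_delta : 'I_tm_q.+1 -> 'I_tm_s.+3 -> option ('I_tm_q.+1 * 'I_tm_s.+3 * move)
}.

Record config (M : TM) := Config {
  c_state : 'I_(tm_q M).+1;
  c_left : seq 'I_(tm_s M).+3;   (* cells left of the head, nearest first *)
  c_head : 'I_(tm_s M).+3;
  c_right : seq 'I_(tm_s M).+3   (* cells right of the head, nearest first *)
}.

Definition blank (M : TM) : 'I_(tm_s M).+3 := ord0.

Definition bit_sym (M : TM) (b : bool) : 'I_(tm_s M).+3 :=
  if b then inord 2 else inord 1.

Definition sym_bit (M : TM) (a : 'I_(tm_s M).+3) : option bool :=
  if val a == 1 then Some false else if val a == 2 then Some true else None.

Definition tm_step (M : TM) (k : config M) : config M :=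
  match @tm_delta M (c_state k) (c_head k) with
  | None => k
  | Some (q', w, mv) =>
      match mv with
      | MoveS => @Config M q' (c_left k) w (c_right k)
      | MoveL =>
          match c_left k with
          | [::] => @Config M q' [::] w (c_right k)   (* left end: stay *)
          | a :: l => @Config M q' l a (w :: c_right k)
          end
      | MoveR =>
          match c_right k with
          | [::] => @Config M q' (w :: c_left k) (blank M) [::]
          | a :: r => @Config M q' (w :: c_left k) a r
          end
      end
  end.

Definition tm_init (M : TM) (x : seq bool) : config M :=
  let t := map (bit_sym M) x in
  @Config M ord0 [::] (head (blank M) t) (behead t).

Definition tm_halted (M : TM) (k : config M) : bool :=
  if @tm_delta M (c_state k) (c_head k) is None then true else false.

Fixpoint read_bits (M : TM) (s : seq 'I_(tm_s M).+3) : seq bool :=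
  match s with
  | [::] => [::]
  | a :: s' => if sym_bit a is Some b then b :: read_bits s' else [::]
  end.

Definition tm_output (M : TM) (k : config M) : seq bool :=
  read_bits (c_head k :: c_right k).

Definition computes_within (M : TM) (x y : seq bool) (T : nat) : Prop :=
  let k := iter T (tm_step (M:=M)) (tm_init M x) in
  tm_halted k /\ tm_output k = y.

Definition poly_reducible (VA A VB B : instance -> Prop) : Prop :=
  exists (M : TM) (c d : nat),
    forall I, VA I ->
      exists J, [/\ VB J,
                    computes_within M (encode I) (encode J)
                      (c * (size (encode I)).+1 ^ d)
                  & (A I <-> B J)].

(* Main.v *)
Require Import Defs.
From Stdlib Require Import FunctionalExtensionality.
From mathcomp Require Import all_boot zify.

(** Let G have vertices 0..n-1.  The target DAG has, for each pair q = (u, v), five vertices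
a_q, s_q, p_q, t_q, b_q (kinds 0..4), with arcs a_q -> b_q and s_q -> p_q -> t_q; for each arc
(u, v) of G it also has a_(u,v) -> p_(w,v) and p_(w,u) -> b_(u,v) for all w, so that all the
p_(w,v) stand for the vertex v.  If {a_(u,v), b_(u,v)} is a block, the quotient has a path from
p_(w,u) to p_(w,v): keeping the arc (u, v) amounts to choosing this block, and acyclicity of
the quotient is acyclicity of the kept arcs.  No path has more than three vertices, and a path
with more than one vertex that avoids the p's is some {a_q, b_q}; hence a partition has at
least 2n^2 + |F| blocks, F being the set of pairs q for which {a_q, b_q} is not a block.  The
blocks {s_q, p_q, t_q} show that this is attained, so the target bound is 2n^2 + K.

The target is computed with a bounded number of pointers into the input and an append-only
output.  On the single tape, a cell carries its input symbol, the set of pointers standing on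
it, an output symbol and a flag for cell 0; an instruction scans right for its cell, edits it
and its neighbour, and returns to cell 0. *)

Set Implicit Arguments.
Unset Strict Implicit.
Unset Printing Implicit Defensive.

(** * Machine fragments *)

(* Two groups of pointers, for the row and the column of the matrix entry being written; in a
   group, [Some false] and [Some true] hold a pair (i, j) and [None] its matrix position. *)
Definition pointer : finType := (bool * option bool)%type.

Definition symbol : finType := (option bool * bool * {set pointer} * option bool)%type.

Definition raw (o : option bool) : symbol := (o, false, set0, None).

Definition sym_in (a : symbol) : option bool := a.1.1.1.
Definition sym_home (a : symbol) : bool := a.1.1.2.
Definition sym_marks (a : symbol) : {set pointer} := a.1.2.
Definition sym_out (a : symbol) : option bool := a.2.

Definition tape : Type := (nat * (nat -> symbol))%type.

(* [inr b] is the exit of a fragment with result b. *)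
Record frag := Frag {
  fQ : finType;
  fstart : fQ;
  fdelta : fQ -> symbol -> (fQ + bool) * symbol * move
}.

Definition upd (f : nat -> symbol) (p : nat) (w : symbol) : nat -> symbol :=
  fun i => if i == p then w else f i.

Definition tape_act (w : symbol) (mv : move) (t : tape) : tape :=
  (match mv with MoveL => t.1.-1 | MoveR => t.1.+1 | MoveS => t.1 end,
   upd t.2 t.1 w).

Definition fstep (M : frag) (c : (fQ M + bool) * tape) : (fQ M + bool) * tape :=
  match c.1 with
  | inr _ => c
  | inl q => let: (q', w, mv) := fdelta q (c.2.2 c.2.1) in (q', tape_act w mv c.2)
  end.

(** Only an upper bound on the time is recorded: exit configurations are fixed by [fstep], so an
    early exit is still visible at any later time. *)
Definition freach (M : frag) (c : (fQ M + bool) * tape) (n : nat)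
    (c' : (fQ M + bool) * tape) : Prop :=
  exists2 t, t <= n & iter t (@fstep M) c = c'.

Definition exec (M : frag) (t : tape) (n : nat) (b : bool) (t' : tape) : Prop :=
  freach (inl (fstart M), t) n (inr b, t').

Lemma freach_trans (M : frag) c1 n1 c2 n2 c3 :
  @freach M c1 n1 c2 -> @freach M c2 n2 c3 -> @freach M c1 (n1 + n2) c3.
Proof.
move=> [t1 le1 e1] [t2 le2 e2]; exists (t1 + t2); first exact: leq_add.
by rewrite addnC iterD e1.
Qed.

Lemma freach_weaken (M : frag) c n n' c' :
  n <= n' -> @freach M c n c' -> @freach M c n' c'.
Proof. by move=> le_n [t le_t e]; exists t => //; apply: leq_trans le_n. Qed.

Lemma freach_refl (M : frag) c n : @freach M c n c.
Proof. by exists 0. Qed.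

Lemma freach_step (M : frag) c n c' :
  @freach M (fstep c) n c' -> @freach M c n.+1 c'.
Proof. by move=> [t le_t e]; exists t.+1 => //; rewrite iterSr. Qed.

Lemma iter_exit (M : frag) t b tp :
  iter t (@fstep M) (inr b, tp) = (inr b, tp).
Proof. by elim: t => //= t ->. Qed.

(** One simulation serves both branches and loops: [N] copies [M] on the states [f q] and redirects
    its exits through [g]. The redirection is part of the exiting transition, so it costs no
    step. *)
Lemma embed_exec (M N : frag) (f : fQ M -> fQ N) (g : bool -> fQ N + bool) :
  (forall q a, fdelta (f q) a =
     let: (q', w, mv) := fdelta q a in
     (match q' with inl x => inl (f x) | inr b => g b end, w, mv)) ->
  forall q tp n b tp', @freach M (inl q, tp) n (inr b, tp') ->
    @freach N (inl (f q), tp) n (g b, tp').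
Proof.
move=> hfg q tp n b tp' [t le_t e].
suff: @freach N (inl (f q), tp) t (g b, tp') by apply: freach_weaken.
elim: t q tp {le_t} e => // t IHt q tp; rewrite iterSr {2}/fstep /=.
have := hfg q (tp.2 tp.1).
case E: (fdelta q (tp.2 tp.1)) => [[[q'|b'] w] mv] /= hf e; apply: freach_step.
  by rewrite /fstep /= hf; apply: IHt.
(* [M] has exited: its remaining iterations change nothing, and a single step of [N] lands in the
   redirected state. *)
move: e; rewrite iter_exit => -[<- <-].
by rewrite /fstep /= hf; apply: freach_refl.
Qed.

(** * Branching and iteration of fragments *)

Section Branch.
Variables Mt M1 M2 : frag.

Definition branch_delta (q : fQ Mt + (fQ M1 + fQ M2)) (a : symbol) :
    (fQ Mt + (fQ M1 + fQ M2) + bool) * symbol * move :=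
  match q with
  | inl q0 => let: (q', w, mv) := fdelta q0 a in
      (match q' with
       | inl x => inl (inl x)
       | inr b => inl (inr (if b then inl (fstart M1) else inr (fstart M2)))
       end, w, mv)
  | inr (inl q1) => let: (q', w, mv) := fdelta q1 a in
      (match q' with inl x => inl (inr (inl x)) | inr b => inr b end, w, mv)
  | inr (inr q2) => let: (q', w, mv) := fdelta q2 a in
      (match q' with inl x => inl (inr (inr x)) | inr b => inr b end, w, mv)
  end.

Definition branch : frag := Frag (inl (fstart Mt)) branch_delta.

Lemma exec_branch t n b t1 n1 b1 t2 :
  exec Mt t n b t1 -> exec (if b then M1 else M2) t1 n1 b1 t2 ->
  exec branch t (n + n1) b1 t2.
Proof.
move=> e1 e2; apply: freach_trans.
  exact: (@embed_exec Mt branch inl (fun b => inl (inr (if b then inl (fstart M1)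
    else inr (fstart M2)))) _ _ _ _ _ _ e1).
case: b e1 e2 => _ e2.
  exact: (@embed_exec M1 branch (fun x => inr (inl x)) inr _ _ _ _ _ _ e2).
exact: (@embed_exec M2 branch (fun x => inr (inr x)) inr _ _ _ _ _ _ e2).
Qed.

End Branch.

Section Loop.
Variables Mt Mb : frag.

Definition loop_delta (q : fQ Mt + fQ Mb) (a : symbol) :
    (fQ Mt + fQ Mb + bool) * symbol * move :=
  match q with
  | inl q0 => let: (q', w, mv) := fdelta q0 a in
      (match q' with
       | inl x => inl (inl x)
       | inr b => if b then inl (inr (fstart Mb)) else inr false
       end, w, mv)
  | inr q1 => let: (q', w, mv) := fdelta q1 a in
      (match q' with inl x => inl (inr x) | inr _ => inl (inl (fstart Mt)) end, w, mv)
  end.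

Definition loop : frag := Frag (inl (fstart Mt)) loop_delta.

Let exec_test t n b t1 : exec Mt t n b t1 ->
  @freach loop (inl (fstart loop), t) n
    (if b then inl (inr (fstart Mb)) else inr false, t1).
Proof.
exact: (@embed_exec Mt loop inl
  (fun b => if b then inl (inr (fstart Mb)) else inr false)).
Qed.

Lemma exec_loop_false t n t1 : exec Mt t n false t1 -> exec loop t n false t1.
Proof. exact: exec_test. Qed.

Lemma exec_loop_true t n t1 n1 b1 t2 n2 b2 t3 :
  exec Mt t n true t1 -> exec Mb t1 n1 b1 t2 -> exec loop t2 n2 b2 t3 ->
  exec loop t (n + n1 + n2) b2 t3.
Proof.
move=> e1 e2 e3; apply: freach_trans e3; apply: freach_trans (exec_test e1) _.
exact: (@embed_exec Mb loop inr (fun=> inl (inl (fstart Mt))) _ _ _ _ _ _ e2).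
Qed.

End Loop.

(** * One trip from cell 0 to a cell and back *)

Section Visit.
Variables (find : pred symbol) (f1 : symbol -> symbol) (res : pred symbol).
Variables (f2 f3 : symbol -> symbol).

(** State [None] scans right; [Some (false, b)] stands on the right neighbour of the cell found;
    [Some (true, b)] returns to the home cell, carrying the result [b]. *)
Definition visit_delta (q : option (bool * bool)) (a : symbol) :
    (option (bool * bool) + bool) * symbol * move :=
  match q with
  | None => if find a then (inl (Some (false, res a)), f1 a, MoveR)
            else (inl None, a, MoveR)
  | Some (false, b) => (inl (Some (true, b)), f2 a, MoveL)
  | Some (true, b) => if sym_home a then (inr b, f3 a, MoveS)
                      else (inl (Some (true, b)), a, MoveL)
  end.

Definition visit : frag := Frag None visit_delta.

(** At cell 0 the edit [f3] comes last, because the trip ends there; the order matters when [p] is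
    0. *)
Definition visit_tape (p : nat) (F : nat -> symbol) (i : nat) : symbol :=
  let a := if i == p then f1 (F i) else if i == p.+1 then f2 (F i) else F i in
  if i == 0 then f3 a else a.

Lemma upd_id F p : upd F p (F p) = F.
Proof. by apply: functional_extensionality => i; rewrite /upd; case: eqP => [->|]. Qed.

Lemma visit_scan p F d : (forall i, i < p -> ~~ find (F i)) -> d <= p ->
  @freach visit (inl None, (p - d, F)) d (inl None, (p, F)).
Proof.
move=> nf; elim: d => [|d IHd] le_d; first by rewrite subn0; apply: freach_refl.
apply: freach_step; rewrite /fstep /= (negbTE (nf _ _)); last by lia.
rewrite /tape_act /= upd_id (_ : (p - d.+1).+1 = p - d); last by lia.
by apply: IHd; lia.
Qed.

Lemma visit_return p F b :
  sym_home (F 0) -> (forall i, sym_home (F i.+1) = false) ->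
  @freach visit (inl (Some (true, b)), (p, F)) p.+1 (inr b, (0, upd F 0 (f3 (F 0)))).
Proof.
move=> h0 h1; elim: p => [|p IHp]; apply: freach_step; rewrite /fstep /=.
  by rewrite h0; apply: freach_refl.
by rewrite h1 /tape_act /= upd_id.
Qed.

Lemma exec_visit p F :
  (forall i, sym_home (F i) = (i == 0)) ->
  (forall a, sym_home (f1 a) = sym_home a) ->
  (forall a, sym_home (f2 a) = sym_home a) ->
  find (F p) -> (forall i, i < p -> ~~ find (F i)) ->
  exec visit (0, F) (2 * p + 3) (res (F p)) (0, visit_tape p F).
Proof.
move=> hF h1 h2 fp nf.
(* [p] scanning steps, one step on the cell, one on its neighbour, and [p.+1] for the return with
   the exit. *)
have -> : 2 * p + 3 = p + p.+3 by lia.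
apply: freach_trans.
  by have := visit_scan nf (leqnn p); rewrite subnn; apply.
apply: freach_step; rewrite /fstep /= fp.
apply: freach_step; rewrite /fstep /=.
rewrite /tape_act /=; set F1 := upd _ p.+1 _.
have eF1 i : F1 i = if i == p then f1 (F i) else if i == p.+1 then f2 (F i) else F i.
  rewrite /F1 /upd (gtn_eqF (ltnSn p)).
  case: (i =P p.+1) => [->|_]; first by rewrite gtn_eqF.
  by case: eqP => [->|].
have h i : sym_home (F1 i) = (i == 0).
  by rewrite eF1; case: ifP => _; [rewrite h1|case: ifP => _; [rewrite h2|]].
have -> : visit_tape p F = upd F1 0 (f3 (F1 0)).
  apply: functional_extensionality => i; rewrite /visit_tape /upd !eF1.
  by case: eqP => [->|].
apply: visit_return => [|i]; first by rewrite h.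
by rewrite h.
Qed.

End Visit.

(** * Instructions and programs *)

Record store := Store { ptr : bool -> option bool -> nat; out : seq bool }.

Definition set_ptr (s : store) (b : bool) (o : option bool) (x : nat) : store :=
  Store (fun b' o' => if (b' == b) && (o' == o) then x else ptr s b' o') (out s).

Definition emit_bit (s : store) (c : bool) : store := Store (ptr s) (rcons (out s) c).

Definition bounded (B : nat) (s : store) : Prop :=
  (forall b o, ptr s b o <= B) /\ size (out s) <= B.

Lemma bounded_weaken B B' s : B <= B' -> bounded B s -> bounded B' s.
Proof.
by move=> le_B [h1 h2]; split=> [b o|]; apply: leq_trans le_B.
Qed.

Definition opInc (b : bool) (o : option bool) : frag :=
  visit (fun a => (b, o) \in sym_marks a)
    (fun a => (a.1.1, sym_marks a :\ (b, o), a.2)) (fun=> true)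
    (fun a => (a.1.1, (b, o) |: sym_marks a, a.2)) id.

(** The mark is put on cell 0 at the end of the trip, after its removal, so a pointer already at 0
    stays there. *)
Definition opReset (b : bool) (o : option bool) : frag :=
  visit (fun a => (b, o) \in sym_marks a)
    (fun a => (a.1.1, sym_marks a :\ (b, o), a.2)) (fun=> true)
    id (fun a => (a.1.1, (b, o) |: sym_marks a, a.2)).

(** The end of the output is recognised as the first cell with an empty output component. *)
Definition opEmit (c : bool) : frag :=
  visit (fun a => sym_out a == None) (fun a => (a.1, Some c)) (fun=> true) id id.

Definition testIn (b : bool) (o : option bool) : frag :=
  visit (fun a => (b, o) \in sym_marks a) id (fun a => sym_in a == Some true) id id.

Definition testEq (b : bool) (o : option bool) (b' : bool) (o' : option bool) : frag :=
  visit (fun a => (b, o) \in sym_marks a) id (fun a => (b', o') \in sym_marks a) id id.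

Section Programs.
Variable x : seq bool.

Definition cell (s : store) (i : nat) : symbol :=
  (onth x i, i == 0, [set j : pointer | ptr s j.1 j.2 == i], onth (out s) i).

(* An instruction moves a pointer, or extends the output, by at most one cell; so the
   cost in machine steps is controlled by the number of instructions alone. *)
Definition runs (M : frag) (s : store) (m : nat) (b : bool) (s' : store) : Prop :=
  forall B, bounded B s ->
    bounded (B + m) s' /\ exec M (0, cell s) (m * (2 * (B + m) + 3)) b (0, cell s').

Lemma cell_home s i : sym_home (cell s i) = (i == 0).
Proof. by []. Qed.

Lemma in_cell s i b o : ((b, o) \in sym_marks (cell s i)) = (ptr s b o == i).
Proof. by rewrite inE. Qed.

(** Reduces an instruction to a cellwise identity between the edited tape and the tape of the new
    store. *)
Lemma runs_visit (find res : pred symbol) f1 f2 f3 s s' p :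
  (forall a, sym_home (f1 a) = sym_home a) ->
  (forall a, sym_home (f2 a) = sym_home a) ->
  find (cell s p) -> (forall i, i < p -> ~~ find (cell s i)) ->
  (forall B, bounded B s -> p <= B /\ bounded B.+1 s') ->
  visit_tape f1 f2 f3 p (cell s) =1 cell s' ->
  runs (visit find f1 res f2 f3) s 1 (res (cell s p)) s'.
Proof.
move=> h1 h2 fp nf hB e B /hB [le_p hs']; split; first by rewrite addn1.
have -> : cell s' = visit_tape f1 f2 f3 p (cell s).
  by apply: functional_extensionality => i; rewrite e.
apply: freach_weaken (exec_visit res f3 (cell_home s) h1 h2 fp nf).
by lia.
Qed.

Lemma runs_inc s b o : runs (opInc b o) s 1 true (set_ptr s b o (ptr s b o).+1).
Proof.
apply: (@runs_visit _ (fun=> true) _ _ _ _ _ (ptr s b o)) => //.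
- by rewrite in_cell.
- by move=> i lt_i; rewrite in_cell gtn_eqF.
- move=> B [h1 h2]; split; first exact: h1.
  split; last exact: leqW.
  by move=> b' o' /=; case: ifP => _; [rewrite ltnS | apply: leqW].
move=> i; rewrite /visit_tape /cell /sym_marks /=.
case: (i =P ptr s b o) => [->|ne1]; last case: (i =P (ptr s b o).+1) => [->|ne2].
all: rewrite ?if_same; congr (_, _, _); apply/setP=> -[b' o']; rewrite !inE /= ?xpair_eqE.
all: case E: ((b' == b) && (o' == o)) => //=; case/andP: E => /eqP ? /eqP ?; subst b' o'.
all: rewrite ?eqxx //.
all: lia.
Qed.

Lemma runs_reset s b o : runs (opReset b o) s 1 true (set_ptr s b o 0).
Proof.
apply: (@runs_visit _ (fun=> true) _ _ _ _ _ (ptr s b o)) => //.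
- by rewrite in_cell.
- by move=> i lt_i; rewrite in_cell gtn_eqF.
- move=> B [h1 h2]; split; first exact: h1.
  split; last exact: leqW.
  by move=> b' o' /=; case: ifP => _ //; apply: leqW.
move=> i; rewrite /visit_tape /cell /sym_marks /=.
case: (i =P ptr s b o) => [->|ne1]; rewrite ?if_same.
all: case: eqP => e0 /=; congr (_, _, _); apply/setP=> -[b' o']; rewrite !inE /= ?xpair_eqE.
all: case E: ((b' == b) && (o' == o)) => //=; case/andP: E => /eqP ? /eqP ?; subst b' o'.
all: lia.
Qed.

Lemma onth_size (s : seq bool) : onth s (size s) = None.
Proof. by elim: s. Qed.

Lemma onth_lt (s : seq bool) i : i < size s -> onth s i != None.
Proof. by elim: s i => [|a s IHs] [|i] //= /IHs. Qed.

Lemma onth_rcons (s : seq bool) c i :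
  onth (rcons s c) i = if i == size s then Some c else onth s i.
Proof. by elim: s i => [|a s IHs] [|i] //=; case: i. Qed.

Lemma runs_emit s c : runs (opEmit c) s 1 true (emit_bit s c).
Proof.
apply: (@runs_visit _ (fun=> true) _ _ _ _ _ (size (out s))) => //.
- by rewrite /sym_out /= onth_size.
- by move=> i lt_i; apply: onth_lt.
- move=> B [h1 h2]; split=> //; split; last by rewrite size_rcons.
  by move=> b o; apply: leqW (h1 b o).
by move=> i; rewrite /visit_tape /cell /= onth_rcons !if_same; case: eqP.
Qed.

Lemma runs_testIn s b o :
  runs (testIn b o) s 1 (onth x (ptr s b o) == Some true) s.
Proof.
have h := @runs_visit (fun a => (b, o) \in sym_marks a)
  (fun a => sym_in a == Some true) id id id s s (ptr s b o).
apply: h => //.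
- by rewrite in_cell.
- by move=> i lt_i; rewrite in_cell gtn_eqF.
- move=> B hB; split; first by case: hB.
  exact: bounded_weaken hB.
by move=> i; rewrite /visit_tape !if_same.
Qed.

Lemma runs_testEq s b o b' o' :
  runs (testEq b o b' o') s 1 (ptr s b' o' == ptr s b o) s.
Proof.
have h := @runs_visit (fun a => (b, o) \in sym_marks a)
  (fun a => (b', o') \in sym_marks a) id id id s s (ptr s b o).
rewrite -in_cell; apply: h => //.
- by rewrite in_cell.
- by move=> i lt_i; rewrite in_cell gtn_eqF.
- move=> B hB; split; first by case: hB.
  exact: bounded_weaken hB.
by move=> i; rewrite /visit_tape !if_same.
Qed.

Lemma runs_weaken M s m m' b s' : m <= m' -> runs M s m b s' -> runs M s m' b s'.
Proof.
move=> le_m h B /h [h1 h2]; split.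
  by apply: bounded_weaken h1; rewrite leq_add2l.
by apply: freach_weaken h2; apply: leq_mul => //; lia.
Qed.

(** The cost is superadditive: the second part starts within [B + m], so every instruction of either
    part costs at most [2 * (B + (m + m1)) + 3]. *)
Lemma runs_branch Mt M1 M2 s m b s1 m1 b1 s2 :
  runs Mt s m b s1 -> runs (if b then M1 else M2) s1 m1 b1 s2 ->
  runs (branch Mt M1 M2) s (m + m1) b1 s2.
Proof.
move=> r1 r2 B /r1 [/r2 [h2 e2] e1]; split; first by rewrite addnA.
apply: freach_weaken (exec_branch e1 e2).
by rewrite mulnDl; apply: leq_add; apply: leq_mul => //; lia.
Qed.

Lemma runs_loop_false Mt Mb s m s1 :
  runs Mt s m false s1 -> runs (loop Mt Mb) s m false s1.
Proof. by move=> r B /r [h e]; split=> //; apply: exec_loop_false. Qed.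

Lemma runs_loop_true Mt Mb s m s1 m1 b1 s2 m2 b2 s3 :
  runs Mt s m true s1 -> runs Mb s1 m1 b1 s2 -> runs (loop Mt Mb) s2 m2 b2 s3 ->
  runs (loop Mt Mb) s (m + m1 + m2) b2 s3.
Proof.
move=> r1 r2 r3 B /r1 [/r2 [/r3 [h e3] e2] e1]; split; first by rewrite !addnA in h *.
apply: freach_weaken (exec_loop_true e1 e2 e3).
by rewrite !mulnDl; apply: leq_add; [apply: leq_add|]; apply: leq_mul => //; lia.
Qed.

Definition triple (P : store -> Prop) (M : frag) (m : nat) (Q : store -> Prop) : Prop :=
  forall s, P s -> exists b s', runs M s m b s' /\ Q s'.

Lemma triple_weaken P M m m' (Q Q' : store -> Prop) :
  m <= m' -> (forall s, Q s -> Q' s) -> triple P M m Q -> triple P M m' Q'.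
Proof.
move=> le_m hQ h s /h [b [s' [r q]]]; exists b, s'; split; last exact: hQ.
exact: runs_weaken r.
Qed.

Lemma triple_seq P M m Q M' m' R :
  triple P M m Q -> triple Q M' m' R -> triple P (branch M M' M') (m + m') R.
Proof.
move=> h h' s /h [b [s1 [r1 /h' [b2 [s2 [r2 hR]]]]]]; exists b2, s2; split=> //.
by apply: runs_branch r1 _; case: b.
Qed.

(** The invariant is indexed by the number of completed rounds. Each round pays for its test, and
    one failing test is added at the end. *)
Lemma triple_loop (J : nat -> store -> Prop) Mt Mb k m :
  (forall i s, i <= k -> J i s -> runs Mt s 1 (i < k) s) ->
  (forall i, i < k -> triple (J i) Mb m (J i.+1)) ->
  triple (J 0) (loop Mt Mb) (k * m.+1).+1 (J k).
Proof.
move=> ht hb.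
(* Induction on the number [d] of rounds still to come. *)
suff h d : d <= k -> triple (J (k - d)) (loop Mt Mb) (d * m.+1).+1 (J k).
  by have := h k (leqnn k); rewrite subnn.
elim: d => [|d IHd] le_d s.
  rewrite subn0 => hs; exists false, s; split=> //.
  by apply: runs_loop_false; rewrite -[false](ltnn k); apply: ht.
move=> hs; have lt_d : k - d.+1 < k by lia.
have [b1 [s1 [r1 hs1]]] := hb _ lt_d _ hs.
have e : (k - d.+1).+1 = k - d by lia.
rewrite e in hs1; have [b2 [s2 [r2 hs2]]] := IHd (ltnW le_d) _ hs1.
exists b2, s2; split=> //.
have r0 : runs Mt s 1 true s by have := ht _ _ (ltnW lt_d) hs; rewrite lt_d.
by apply: runs_weaken (runs_loop_true r0 r1 r2); lia.
Qed.

Lemma triple_inc (P Q : store -> Prop) b o :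
  (forall s, P s -> Q (set_ptr s b o (ptr s b o).+1)) -> triple P (opInc b o) 1 Q.
Proof. by move=> h s /h hQ; eexists; eexists; split; first exact: runs_inc. Qed.

Lemma triple_reset (P Q : store -> Prop) b o :
  (forall s, P s -> Q (set_ptr s b o 0)) -> triple P (opReset b o) 1 Q.
Proof. by move=> h s /h hQ; eexists; eexists; split; first exact: runs_reset. Qed.

Lemma triple_emit (P Q : store -> Prop) c :
  (forall s, P s -> Q (emit_bit s c)) -> triple P (opEmit c) 1 Q.
Proof. by move=> h s /h hQ; eexists; eexists; split; first exact: runs_emit. Qed.

(** * Loops over pairs of numbers, and the program of the reduction *)

Section ForPair.
Variable n : nat.
Hypothesis x_lt : forall i, i < n -> onth x i = Some true.
Hypothesis x_n : onth x n = Some false.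

Lemma runs_testIn_lt s b o : ptr s b o <= n -> runs (testIn b o) s 1 (ptr s b o < n) s.
Proof.
move=> le_n; have := @runs_testIn s b o.
case: (ltnP (ptr s b o) n) => h; first by rewrite x_lt.
by have -> : ptr s b o = n by [lia]; rewrite x_n.
Qed.

Definition seqn (M M' : frag) : frag := branch M M' M'.

(* The first n+1 cells of the input hold n ones and a zero: a pointer to cell i, read
   as the number i, is compared with n by reading the input below it. *)
Definition for_pair (b : bool) (body : frag) : frag :=
  seqn (opReset b None)
  (seqn (loop (testIn b None) (opInc b None))
  (seqn (opInc b None)
  (seqn (opReset b (Some false))
        (loop (testIn b (Some false))
          (seqn (opReset b (Some true))
          (seqn (loop (testIn b (Some true))
                  (seqn body (seqn (opInc b None) (opInc b (Some true)))))
                (opInc b (Some false)))))))).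

(** The matrix is stored by rows after [n] ones and a zero, whence the position of the pointer
    [None]. *)
Definition at_pair (b : bool) (i j : nat) (s : store) : Prop :=
  [/\ ptr s b (Some false) = i, ptr s b (Some true) = j
    & ptr s b None = n.+1 + (i * n + j)].

Definition pair_out (g : nat -> nat -> seq bool) : seq bool :=
  flatten [seq flatten [seq g i j | j <- iota 0 n] | i <- iota 0 n].

Lemma flatten_iotaS (g : nat -> seq bool) k :
  flatten [seq g i | i <- iota 0 k.+1] = flatten [seq g i | i <- iota 0 k] ++ g k.
Proof. by rewrite -addn1 iotaD map_cat flatten_cat /= cats0. Qed.

Lemma set_ptr_other s b o k : ptr (set_ptr s b o k) (~~ b) = ptr s (~~ b).
Proof. by apply: functional_extensionality => o' /=; case: b. Qed.

(** An inner round costs [t.+3]: the body, a test and two increments. An outer round adds 4: its own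
    test, the failing inner test, a reset and an increment. *)
Definition pair_cost (t : nat) : nat := 1 + (n * 2).+1 + 1 + 1 + (n * (n * t.+3 + 4)).+1.

(** [Phi] is a frame for the other pointer group, which may hold the pair of an enclosing loop. The
    final position of [None] is the first cell past the matrix. *)
Lemma triple_for_pair b body t g (Phi : (option bool -> nat) -> Prop) o :
  (forall i j o', i < n -> j < n ->
     triple (fun s => [/\ at_pair b i j s, Phi (ptr s (~~ b)) & out s = o'])
       body t
       (fun s => [/\ at_pair b i j s, Phi (ptr s (~~ b)) & out s = o' ++ g i j])) ->
  triple (fun s => Phi (ptr s (~~ b)) /\ out s = o)
    (for_pair b body) (pair_cost t)
    (fun s => [/\ ptr s b None = n.+1 + n * n, Phi (ptr s (~~ b))
                & out s = o ++ pair_out g]).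
Proof.
move=> hbody; rewrite /pair_cost -!addnA.
apply: (@triple_seq _ _ _ (fun s => [/\ ptr s b None = 0, Phi (ptr s (~~ b)) & out s = o])).
  by apply: triple_reset => s [h1 h2]; rewrite set_ptr_other /= !eqxx.
apply: (@triple_seq _ _ _ (fun s => [/\ ptr s b None = n, Phi (ptr s (~~ b)) & out s = o])).
  apply: (@triple_loop (fun i s => [/\ ptr s b None = i, Phi (ptr s (~~ b)) & out s = o])).
    by move=> i s le_i [e _ _]; subst i; apply: runs_testIn_lt.
  move=> i lt_i; apply: triple_inc => s [h0 h1 h2].
  by rewrite set_ptr_other /= !eqxx h0.
apply: (@triple_seq _ _ _ (fun s => [/\ ptr s b None = n.+1, Phi (ptr s (~~ b)) & out s = o])).
  apply: triple_inc => s [h0 h1 h2].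
  by rewrite set_ptr_other /= !eqxx h0.
pose g1 i := flatten [seq g i j | j <- iota 0 n].
pose J i s := [/\ ptr s b (Some false) = i, ptr s b None = n.+1 + i * n,
  Phi (ptr s (~~ b)) & out s = o ++ flatten [seq g1 i | i <- iota 0 i]].
apply: (@triple_seq _ _ _ (J 0)).
  apply: triple_reset => s [h0 h1 h2].
  by split; rewrite ?set_ptr_other //= ?eqxx ?andbF ?h0 ?addn0 ?cats0.
apply: (@triple_weaken _ _ (n * (n * t.+3 + 4)).+1 _ (J n)) => //.
  by move=> s [].
have -> : n * t.+3 + 4 = (1 + ((n * t.+3).+1 + 1)).+1 by lia.
apply: triple_loop => [i s le_i [e _ _ _]|i lt_i].
  by subst i; apply: runs_testIn_lt.
pose J1 j s := [/\ at_pair b i j s, Phi (ptr s (~~ b)) &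
   out s = o ++ flatten [seq g1 i | i <- iota 0 i] ++ flatten [seq g i j | j <- iota 0 j]].
apply: (@triple_seq _ _ _ (J1 0)).
  apply: triple_reset => s [h0 h1 h2 h3].
  by split; rewrite ?set_ptr_other /= ?cats0 //; split; rewrite /= ?eqxx ?andbF ?addn0.
apply: (@triple_seq _ _ _ (J1 n)).
  apply: triple_loop => [j s le_j [[_ e _] _ _]|j lt_j].
    by subst j; apply: runs_testIn_lt.
  rewrite -addn2; apply: triple_seq => [s hs|].
    by apply: (hbody i j _ lt_i lt_j s); case: hs => h1 h2 h3; split=> //; exact: h3.
  apply: (@triple_seq _ _ 1 (fun s => [/\ ptr s b (Some false) = i,
     ptr s b (Some true) = j, ptr s b None = n.+1 + (i * n + j.+1), Phi (ptr s (~~ b)) &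
     out s = (o ++ flatten [seq g1 i | i <- iota 0 i] ++ flatten [seq g i j | j <- iota 0 j])
       ++ g i j]) _ 1).
    apply: triple_inc => s [[h1 h2 h3] h4 h5].
    by split; rewrite ?set_ptr_other //= ?eqxx ?andbF ?h3 ?addnS.
  apply: triple_inc => s [h1 h2 h3 h4 h5].
  split; rewrite ?set_ptr_other //; last by rewrite flatten_iotaS [LHS]h5 -!catA.
  by split=> /=; rewrite ?eqxx ?andbF ?h1 ?h2 ?h3.
apply: triple_inc => s [[h1 h2 h3] h4 h5].
split; rewrite ?set_ptr_other // ?flatten_iotaS //= ?eqxx ?andbF ?h1 ?h3 //.
(* After [n] columns the matrix pointer already stands at the start of the next row. *)
by rewrite mulSn; lia.
Qed.

Definition emit_and (M1 M2 : frag) : frag :=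
  branch M1 (branch M2 (opEmit true) (opEmit false)) (opEmit false).

Lemma triple_emit_and (P Q : store -> Prop) M1 M2 b1 b2 :
  (forall s, P s -> runs M1 s 1 b1 s) -> (forall s, P s -> runs M2 s 1 b2 s) ->
  (forall s, P s -> Q (emit_bit s (b1 && b2))) ->
  triple P (emit_and M1 M2) 3 Q.
Proof.
move=> h1 h2 hQ s hs; exists true, (emit_bit s (b1 && b2)); split; last exact: hQ.
apply: (@runs_branch _ _ _ _ 1 _ _ 2 _ _ (h1 _ hs)).
case: b1 {h1 hQ} => /=; last by apply: runs_weaken (@runs_emit _ _).
apply: (@runs_branch _ _ _ _ 1 _ _ 1 _ _ (h2 _ hs)).
by case: b2 {h2}; apply: runs_emit.
Qed.

Definition for_kind (body : nat -> frag) : frag :=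
  seqn (body 0) (seqn (body 1) (seqn (body 2) (seqn (body 3) (body 4)))).

Lemma triple_for_kind (P : store -> Prop) body t (g : nat -> seq bool) o :
  (forall k o', triple (fun s => P s /\ out s = o') (body k) t
     (fun s => P s /\ out s = o' ++ g k)) ->
  triple (fun s => P s /\ out s = o) (for_kind body) (5 * t)
    (fun s => P s /\ out s = o ++ flatten [seq g k | k <- iota 0 5]).
Proof.
move=> h; have -> : 5 * t = t + (t + (t + (t + t))) by lia.
apply: triple_seq (h 0 _) _; apply: triple_seq (h 1 _) _.
apply: triple_seq (h 2 _) _; apply: triple_seq (h 3 _) _.
apply: triple_weaken (h 4 _) => // s; rewrite -!catA => -[h1 h2]; split=> //.
by rewrite h2 /= cats0.
Qed.

Definition same_pair_kinds : seq (nat * nat) := [:: (0, 4); (1, 2); (2, 3)].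

Definition gadget_bit (e : nat -> nat -> bool) (k i j k' i' j' : nat) : bool :=
  if (k, k') \in same_pair_kinds then (i == i') && (j == j')
  else if (k, k') == (0, 2) then (j == j') && e i j
  else if (k, k') == (2, 4) then (j == i') && e i' j'
  else false.

(** The kinds are constants of the program: the case analysis happens when the program is built, and
    only pointer tests remain at run time. *)
Definition emit_gadget (k k' : nat) : frag :=
  if (k, k') \in same_pair_kinds then
    emit_and (testEq true (Some false) false (Some false))
             (testEq true (Some true) false (Some true))
  else if (k, k') == (0, 2) then
    emit_and (testEq true (Some true) false (Some true)) (testIn false None)
  else if (k, k') == (2, 4) then
    emit_and (testEq true (Some false) false (Some true)) (testIn true None)
  else opEmit false.

Definition input_arc (i j : nat) : bool := onth x (n.+1 + (i * n + j)) == Some true.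

Lemma triple_emit_gadget k k' i j i' j' o :
  triple (fun s => [/\ at_pair true i' j' s, at_pair false i j s & out s = o])
    (emit_gadget k k') 3
    (fun s => [/\ at_pair true i' j' s, at_pair false i j s
                & out s = o ++ [:: gadget_bit input_arc k i j k' i' j']]).
Proof.
rewrite /emit_gadget /gadget_bit; case: ifP => _; last case: ifP => _; last case: ifP => _.
- apply: (@triple_emit_and _ _ _ _ (i == i') (j == j')) => s [[h1 h2 h3] [h4 h5 h6] h7].
  + by rewrite -h4 -h1; apply: runs_testEq.
  + by rewrite -h5 -h2; apply: runs_testEq.
  by split; rewrite //= h7 cats1.
- apply: (@triple_emit_and _ _ _ _ (j == j') (input_arc i j)) => s [[h1 h2 h3] [h4 h5 h6] h7].
  + by rewrite -h5 -h2; apply: runs_testEq.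
  + by rewrite /input_arc -h6; apply: runs_testIn.
  by split; rewrite //= h7 cats1.
- apply: (@triple_emit_and _ _ _ _ (j == i') (input_arc i' j')) => s [[h1 h2 h3] [h4 h5 h6] h7].
  + by rewrite -h5 -h1; apply: runs_testEq.
  + by rewrite /input_arc -h3; apply: runs_testIn.
  by split; rewrite //= h7 cats1.
apply: (@triple_weaken _ _ 1 _ _ _ _ (fun s => id)) => //.
by apply: triple_emit => s [h1 h2 h3]; split; rewrite //= h3 cats1.
Qed.

Definition emit_pairs : frag := for_pair false (opEmit true).

Definition emit_matrix : frag :=
  for_kind (fun k => for_pair false
    (for_kind (fun k' => for_pair true (emit_gadget k k')))).

(** The order is that of [encode]: vertex count, separator, matrix, bound. The last [emit_pairs]
    leaves the matrix pointer at the unary [K] of the input, which the final loop copies. *)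
Definition reduction_program : frag :=
  seqn (for_kind (fun=> emit_pairs))
  (seqn (opEmit false)
  (seqn emit_matrix
  (seqn emit_pairs
  (seqn emit_pairs
        (loop (testIn false None) (seqn (opEmit true) (opInc false None))))))).

Definition matrix_bits : seq bool :=
  flatten [seq pair_out (fun i j =>
      flatten [seq pair_out (fun i' j' => [:: gadget_bit input_arc k i j k' i' j'])
              | k' <- iota 0 5])
    | k <- iota 0 5].

Lemma pair_out_true : pair_out (fun _ _ => [:: true]) = nseq (n * n) true.
Proof.
have h m : flatten [seq [:: true] | _ <- iota 0 m] = nseq m true.
  by elim: m => // m IHm; rewrite flatten_iotaS IHm -addn1 nseqD.
rewrite /pair_out h; elim: {2 3}n => // m IHm.
by rewrite flatten_iotaS IHm mulSn addnC nseqD.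
Qed.

Lemma triple_emit_pairs o :
  triple (fun s => out s = o) emit_pairs (pair_cost 1)
    (fun s => ptr s false None = n.+1 + n * n /\ out s = o ++ nseq (n * n) true).
Proof.
move=> s hs; rewrite -pair_out_true.
have [|b [s' [r [h1 _ h2]]]] :=
  @triple_for_pair false (opEmit true) 1 (fun _ _ => [:: true]) (fun=> True) o _ s (conj I hs).
  move=> i j o' _ _; apply: triple_emit => s0 [h1 h2 h3].
  by split; rewrite //= h3 cats1.
by exists b, s'.
Qed.

Lemma triple_emit_matrix o :
  triple (fun s => out s = o) emit_matrix (5 * pair_cost (5 * pair_cost 3))
    (fun s => out s = o ++ matrix_bits).
Proof.
move=> s hs.
suff [b [s' [r [_ h]]]] : exists b s', runs emit_matrix s (5 * pair_cost (5 * pair_cost 3)) b s'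
    /\ (True /\ out s' = o ++ matrix_bits) by exists b, s'.
move: (conj I hs) => {}hs; move: s hs; apply: triple_for_kind => k o1 s hs.
have [|b [s' [r [h1 _ h2]]]] := @triple_for_pair false
  (for_kind (fun k' => for_pair true (emit_gadget k k'))) (5 * pair_cost 3)
  (fun i j => flatten [seq pair_out (fun i' j' => [:: gadget_bit input_arc k i j k' i' j'])
              | k' <- iota 0 5]) (fun=> True) o1 _ s hs; last by exists b, s'.
move=> i j o2 lt_i lt_j s1 [at1 _ hs1].
have [|b [s2 [r [h1 h2]]]] := @triple_for_kind (at_pair false i j)
  (fun k' => for_pair true (emit_gadget k k')) (pair_cost 3)
  (fun k' => pair_out (fun i' j' => [:: gadget_bit input_arc k i j k' i' j'])) o2 _ s1
  (conj at1 hs1); last by exists b, s2.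
move=> k' o3 s3 hs3.
(* The frame is [at_pair false i j], stated on the row pointers alone; it must survive the loop over
   columns. *)
have [|b [s4 [r [_ h1 h2]]]] := @triple_for_pair true (emit_gadget k k') 3
  (fun i' j' => [:: gadget_bit input_arc k i j k' i' j'])
  (fun pf => [/\ pf (Some false) = i, pf (Some true) = j & pf None = n.+1 + (i * n + j)])
  o3 _ s3 hs3; last by exists b, s4.
by move=> i' j' o4 _ _; apply: triple_emit_gadget.
Qed.

Variable K : nat.
Hypothesis x_K : forall k, k < K -> onth x (n.+1 + n * n + k) = Some true.
Hypothesis x_end : onth x (n.+1 + n * n + K) = None.

Definition reduction_cost : nat :=
  5 * pair_cost 1 + (1 + (5 * pair_cost (5 * pair_cost 3) +
    (pair_cost 1 + (pair_cost 1 + (K * 3).+1)))).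

Lemma triple_reduction_program :
  triple (fun s => out s = [::]) reduction_program reduction_cost
    (fun s => out s = nseq (5 * (n * n)) true ++
       false :: matrix_bits ++ nseq (2 * (n * n) + K) true).
Proof.
rewrite /reduction_cost.
apply: (@triple_seq _ _ _ (fun s => out s = nseq (5 * (n * n)) true)).
  move=> s hs.
  have [|b [s' [r [_ h]]]] := @triple_for_kind (fun=> True) (fun=> emit_pairs) (pair_cost 1)
    (fun=> nseq (n * n) true) [::] _ s (conj I hs).
    move=> k o' s1 [_ /triple_emit_pairs [b [s2 [r [_ h]]]]].
    by exists b, s2.
  exists b, s'; split=> //; rewrite h /= cats0 -!nseqD; congr nseq; lia.
apply: (@triple_seq _ _ 1 (fun s => out s = rcons (nseq (5 * (n * n)) true) false)).
  by apply: triple_emit => s /= ->.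
apply: triple_seq (@triple_emit_matrix _) _.
apply: triple_seq (@triple_emit_pairs _) _.
apply: (@triple_seq _ _ _ (fun s => ptr s false None = n.+1 + n * n /\
  out s = ((rcons (nseq (5 * (n * n)) true) false ++ matrix_bits) ++ nseq (n * n) true)
            ++ nseq (n * n) true)).
  by move=> s [_ hs]; apply: triple_emit_pairs.
set o := _ ++ nseq (n * n) true.
(* The copying loop stops at the first cell after the input, where [onth] returns [None]. *)
pose J k s := ptr s false None = n.+1 + n * n + k /\ out s = o ++ nseq k true.
apply: (@triple_weaken _ _ _ _ (J K)) => [|s [_ ->]|]; first exact: leqnn.
  have -> : 2 * (n * n) + K = n * n + (n * n + K) by lia.
  by rewrite /o !nseqD -cats1 -!catA.
move=> s hs; have : J 0 s by rewrite /J addn0 cats0.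
clear hs; move: s; apply: triple_loop => [k s le_k [h _]|k lt_k].
  have := @runs_testIn s false None; rewrite h.
  case: ltnP => [lt_k|ge_k]; first by rewrite x_K.
  by have -> : k = K by [lia]; rewrite x_end.
apply: (@triple_seq _ _ 1 (fun s => ptr s false None = n.+1 + n * n + k /\
  out s = o ++ nseq k.+1 true) _ 1).
  apply: triple_emit => s [h1 h2]; split=> //=.
  rewrite h2 rcons_cat; congr (_ ++ _); rewrite -cats1.
  by rewrite -[true :: nseq k true]/(nseq k.+1 true) -addn1 nseqD.
by apply: triple_inc => s [h1 h2]; split=> //=; rewrite h1 addnS.
Qed.

End ForPair.
End Programs.

(** * From fragments to Turing machines *)

(** One write suffices: with all pointers at 0 and no output, only cell 0 differs from the raw
    input. *)
Definition fragInit : frag :=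
  @Frag unit tt (fun _ a => (inr true, (sym_in a, true, setT, None), MoveS)).

Definition start_store : store := Store (fun _ _ => 0) [::].

Lemma exec_init x :
  exec fragInit (0, fun i => raw (onth x i)) 1 true (0, cell x start_store).
Proof.
apply: freach_step; rewrite /fstep /= /tape_act /=.
suff -> : upd (fun i => raw (onth x i)) 0 (sym_in (raw (onth x 0)), true, setT, None)
  = cell x start_store by apply: freach_refl.
apply: functional_extensionality => i; rewrite /upd /cell onth0n.
case: i => [|i] /=; first by congr (_, _, _); apply/setP => j; rewrite !inE.
by congr (_, _, _); apply/setP => j; rewrite !inE.
Qed.

(** A blank is written just after the output, and the sweep back strips each cell to its output
    symbol. Cells further right keep old symbols, but reading stops at the blank. *)
Definition fragFinal : frag :=
  @Frag bool false (fun q a =>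
    if q then
      if sym_home a then (inr true, raw (sym_out a), MoveS)
      else (inl true, raw (sym_out a), MoveL)
    else if sym_out a is Some _ then (inl false, a, MoveR)
    else (inl true, raw None, MoveL)).

(** The tape once the sweep back has cleaned the cells from [p] to [size (out s)]. *)
Definition final_tape (x : seq bool) (s : store) (p : nat) (i : nat) : symbol :=
  if i < p then cell x s i
  else if i <= size (out s) then raw (onth (out s) i) else cell x s i.

Lemma exec_final x s : 0 < size (out s) ->
  exec fragFinal (0, cell x s) (2 * size (out s) + 1) true (0, final_tape x s 0).
Proof.
move=> pos; have e : 2 * size (out s) + 1 = size (out s) + (size (out s)).+1 by lia.
have scan d : d <= size (out s) ->
    @freach fragFinal (inl false, (size (out s) - d, cell x s)) d
      (inl false, (size (out s), cell x s)).
  elim: d => [|d IHd] le_d; first by rewrite subn0; apply: freach_refl.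
  apply: freach_step; rewrite /fstep /= /sym_out /=.
  case E: (onth _ _) => [c|]; last first.
    have lt : size (out s) - d.+1 < size (out s) by lia.
    by have := onth_lt lt; rewrite E.
  rewrite /tape_act /= upd_id (_ : (size (out s) - d.+1).+1 = size (out s) - d); last by lia.
  by apply: IHd; lia.
have back p : p < size (out s) ->
    @freach fragFinal (inl true, (p, final_tape x s p.+1)) p.+1
      (inr true, (0, final_tape x s 0)).
  have hF q : final_tape x s q.+1 q = cell x s q by rewrite /final_tape ltnSn.
  have hT q : q < size (out s) ->
      upd (final_tape x s q.+1) q (raw (sym_out (cell x s q))) = final_tape x s q.
    move=> lt_q; apply: functional_extensionality => i; rewrite /upd /final_tape.
    case: (i =P q) => [->|ne]; first by rewrite ltnn (ltnW lt_q).
    by have -> : (i < q.+1) = (i < q) by lia.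
  elim: p => [|p IHp] lt_p; have := hF; have := hT _ lt_p.
    move: (final_tape x s) => F {}hT {}hF; apply: freach_step.
    by rewrite /fstep /= hF /= /tape_act /= hT; apply: freach_refl.
  move: (final_tape x s) IHp => F IHp {}hT {}hF; apply: freach_step.
  by rewrite /fstep /= hF /= /tape_act /= hT; apply: IHp; lia.
rewrite e; apply: freach_trans.
  by have := scan _ (leqnn _); rewrite subnn; apply.
apply: freach_step; rewrite /fstep /= /sym_out /= onth_size.
have := back (size (out s)).-1; rewrite prednK // => /(_ (leqnn _)) hback.
suff -> : tape_act (raw None) MoveL (size (out s), cell x s) =
  ((size (out s)).-1, final_tape x s (size (out s))) by [].
congr (_, _); apply: functional_extensionality => i; rewrite /upd /final_tape.
by case: (ltngtP i (size (out s))) => //= ->; rewrite onth_size.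
Qed.

(** * Numberings with a prescribed beginning *)

Section Enumeration.
Variables (T : finType) (pre : seq T).

Definition rest_enum : seq T := [seq x <- enum T | x \notin pre].

(** Putting [pre] first gives the start state, the blank and the two bits the codes fixed by the
    machine model. *)
Definition index_in (x : T) : nat := index x (pre ++ rest_enum).

Lemma index_in_lt x : index_in x < size pre + size rest_enum.
Proof.
by rewrite -size_cat index_mem mem_cat mem_filter mem_enum andbT orbN.
Qed.

Lemma nth_index_in x0 x : nth x0 (pre ++ rest_enum) (index_in x) = x.
Proof. by apply: nth_index; rewrite mem_cat mem_filter mem_enum andbT orbN. Qed.

Lemma index_in_pre x : x \in pre -> index_in x = index x pre.
Proof. by rewrite /index_in index_cat => ->. Qed.

End Enumeration.

Definition bit_syms : seq symbol := [:: raw None; raw (Some false); raw (Some true)].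

(** * Compilation of a fragment and correctness of the simulation *)

Section Compile.
Variable M : frag.

Definition start_state : seq (fQ M + bool) := [:: inl (fstart M)].

(** One prescribed state and three prescribed symbols come on top of these sizes, so the numberings
    fill ['I_nstates.+1] and ['I_nsyms.+3]. *)
Definition nstates : nat := size (rest_enum start_state).
Definition nsyms : nat := size (rest_enum bit_syms).

Definition enc_state (q : fQ M + bool) : 'I_nstates.+1 := inord (index_in start_state q).
Definition dec_state (i : 'I_nstates.+1) : fQ M + bool :=
  nth (inr false) (start_state ++ rest_enum start_state) i.
Definition enc_sym (a : symbol) : 'I_nsyms.+3 := inord (index_in bit_syms a).
Definition dec_sym (i : 'I_nsyms.+3) : symbol :=
  nth (raw None) (bit_syms ++ rest_enum bit_syms) i.

Lemma enc_stateK : cancel enc_state dec_state.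
Proof.
by move=> q; rewrite /dec_state inordK ?nth_index_in //; have := index_in_lt start_state q.
Qed.

Lemma val_enc_sym a : val (enc_sym a) = index_in bit_syms a.
Proof. by rewrite /= inordK //; have := index_in_lt bit_syms a. Qed.

Lemma enc_symK : cancel enc_sym dec_sym.
Proof. by move=> a; rewrite /dec_sym -[nat_of_ord _]/(val _) val_enc_sym nth_index_in. Qed.

Definition tm_of : TM :=
  @MkTM nstates nsyms (fun q a =>
    match dec_state q with
    | inr _ => None
    | inl q0 => let: (q', w, mv) := fdelta q0 (dec_sym a) in
                Some (enc_state q', enc_sym w, mv)
    end).

(** The default value of [nth] makes the cells to the right of the stored ones blank. *)
Definition simulates (k : config tm_of) (c : (fQ M + bool) * tape) : Prop :=
  [/\ c_state k = enc_state c.1, size (c_left k) = c.2.1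
    & forall i, nth (blank tm_of) (rev (c_left k) ++ c_head k :: c_right k) i
                = enc_sym (c.2.2 i)].

Lemma raw_eqE (o o' : option bool) : (raw o == raw o') = (o == o').
Proof. by rewrite /raw !xpair_eqE !eqxx !andbT. Qed.

Lemma enc_blank : enc_sym (raw None) = blank tm_of.
Proof. by apply: val_inj; rewrite val_enc_sym index_in_pre ?inE ?eqxx //= eqxx. Qed.

Lemma enc_bit b : enc_sym (raw (Some b)) = bit_sym tm_of b.
Proof.
apply: val_inj; rewrite val_enc_sym index_in_pre; last by rewrite !inE !raw_eqE; case: b.
by rewrite /= !raw_eqE; case: b; rewrite /= inordK.
Qed.

Lemma nth_rev_cons (T : Type) (d w h : T) l r i :
  nth d (rev l ++ w :: r) i = if i == size l then w else nth d (rev l ++ h :: r) i.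
Proof.
rewrite !nth_cat size_rev; case: ltngtP => // [lt_i|->]; last by rewrite subnn.
by rewrite -(subnSK lt_i).
Qed.

Lemma simulates_step k c : simulates k c -> simulates (tm_step k) (fstep c).
Proof.
case: k => st l h r; case: c => q [p f] [/= est ep ef].
have eh : h = enc_sym (f p).
  by rewrite -ef nth_cat size_rev ep ltnn subnn.
rewrite /tm_step /= est enc_stateK; case: q est => [q|b] est; last by split.
rewrite /fstep /= eh enc_symK; case: (fdelta q (f p)) => [[q' w] mv] /=.
have hn i : nth (blank tm_of) (rev l ++ enc_sym w :: r) i = enc_sym (upd f p w i).
  by rewrite (nth_rev_cons _ _ h) ef /upd -ep; case: eqP.
case: mv => /=.
(* At the left end both models stay: the machine by its rule, the fragment because [0.-1] is 0. *)
- case: l ep hn {ef} => [|a l] /= ep hn; subst p; first by split.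
  split=> // i; rewrite -hn /=.
  by rewrite rev_cons cat_rcons.
(* With nothing stored on the right, the machine creates a blank, which [nth] already gave by
   default. *)
- case: r hn {ef} => [|a r] hn; split=> //=; rewrite ?ep // => i; rewrite -hn rev_cons.
    rewrite cat_rcons !nth_cat; case: ifP => // _.
    by case: (i - _) => [|[|m]] //=; rewrite ?nth_nil.
  by rewrite cat_rcons.
by split.
Qed.

Lemma simulates_init x :
  simulates (tm_init tm_of x) (inl (fstart M), (0, fun i => raw (onth x i))).
Proof.
split=> //=.
  apply: val_inj; rewrite /= inordK index_in_pre ?mem_head //=; by rewrite eqxx.
move=> i; rewrite -enc_blank.
case: x => [|b x] /=; first by rewrite onth0n; case: i => [|[|i]].
rewrite -[bit_sym tm_of b :: _]/(map (bit_sym tm_of) (b :: x)).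
elim: {b x}(b :: x) i => [|b x IHx] [|i] //=; first by rewrite enc_bit.
Qed.

Lemma read_bits_nth (L : seq 'I_(tm_s tm_of).+3) (y : seq bool) :
  (forall i, i < size y -> nth (blank tm_of) L i = bit_sym tm_of (nth false y i)) ->
  nth (blank tm_of) L (size y) = blank tm_of -> read_bits L = y.
Proof.
have hb b : sym_bit (bit_sym tm_of b) = Some b.
  by rewrite /sym_bit /bit_sym; case: b; rewrite /= inordK.
have ne b : bit_sym tm_of b <> blank tm_of.
  by move=> e; have := hb b; rewrite e.
elim: y L => [|b y IHy] [|a L] //= h h0.
- by rewrite h0.
- by have := h 0 isT => /= e; case: (ne b).
have -> : a = bit_sym tm_of b by exact: (h 0 isT).
by rewrite hb IHy // => i lt_i; apply: (h i.+1).
Qed.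

(** Agreement with [y] is required up to cell [size y] included, since the blank there ends the
    reading. *)
Lemma frag_computes x y T b f :
  exec M (0, fun i => raw (onth x i)) T b (0, f) ->
  (forall i, i <= size y -> f i = raw (onth y i)) ->
  computes_within tm_of x y T.
Proof.
move=> [t le_t e] hf; rewrite /computes_within.
have e' : iter T (@fstep M) (inl (fstart M), (0, fun i => raw (onth x i))) = (inr b, (0, f)).
  by rewrite -(subnK le_t) iterD e iter_exit.
have [] : simulates (iter T (tm_step (M:=tm_of)) (tm_init tm_of x)) (inr b, (0, f)).
  rewrite -e'; elim: T {le_t e'} => [|T IHT]; first exact: simulates_init.
  exact: simulates_step.
case: (iter _ _ _) => st l h r /= est /size0nil -> ef.
split; first by rewrite /tm_halted /= est enc_stateK.
apply: read_bits_nth => [i lt_i|]; rewrite ef hf ?onth_size ?enc_blank //; last exact: ltnW.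
case E: (onth y i) => [c|]; last by have := onth_lt lt_i; rewrite E.
by rewrite (@onth_nth _ false _ _ _ E) enc_bit.
Qed.

End Compile.

(** * The gadget digraph *)

(** Along a cycle the rank would increase strictly from a vertex back to itself. *)
Lemma acyclic_rank (T : eqType) (r : rel T) (f : T -> nat) :
  (forall x y, r x y -> f x < f y) -> acyclic r.
Proof.
move=> hf [|x c] //; apply/negP => /and3P [_ _ /= pc].
have /order_path_min : path (relpre f ltn) x (rcons c x) by apply: sub_path pc.
move=> /(_ (fun y x z => @ltn_trans _ _ _)) /allP /(_ x).
by rewrite mem_rcons mem_head /= ltnn => /(_ isT).
Qed.

(** The rank of a vertex is the number of vertices that reach it. *)
Lemma rank_acyclic (T : finType) (r : rel T) :
  acyclic r -> exists f : T -> nat, forall x y, r x y -> f x < f y.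
Proof.
move=> acy; exists (fun x => #|[set y | connect r y x]|) => x y rxy.
apply: proper_card; apply/properP; split.
  by apply/subsetP => z; rewrite !inE => /connect_trans; apply; apply: connect1.
(* [y] reaches itself but not [x]: a simple path from [y] to [x] would close up with the arc from
   [x] to [y]. *)
exists y; rewrite inE ?connect0 //; apply/negP => /connectP [p pp ex].
case/shortenP: pp ex => p' pp' up _ ex.
have /negP := acy (y :: p'); apply; apply/and3P; split=> //.
by rewrite /= rcons_path pp' -ex.
Qed.

Section Gadget.
Variables (n N : nat) (E : {set 'I_n * 'I_n}) (A : {set 'I_N * 'I_N}).
(** The numbering stays abstract: [mk k q] is the vertex of kind [k] at the pair [q], with [vk] and
    [vp] as inverse. *)
Variable mk : nat -> 'I_n * 'I_n -> 'I_N.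
Variables (vk : 'I_N -> nat) (vp : 'I_N -> 'I_n * 'I_n).
Hypothesis vk_lt : forall x, vk x < 5.
Hypothesis mkK : forall x, mk (vk x) (vp x) = x.
Hypothesis vk_mk : forall k q, k < 5 -> vk (mk k q) = k.
Hypothesis vp_mk : forall k q, k < 5 -> vp (mk k q) = q.
Hypothesis cardN : N = 5 * (n * n).

Definition gadget_arc (k : nat) (q : 'I_n * 'I_n) (k' : nat) (q' : 'I_n * 'I_n) : bool :=
  if (k, k') \in same_pair_kinds then q == q'
  else if (k, k') == (0, 2) then (q.2 == q'.2) && (q \in E)
  else if (k, k') == (2, 4) then (q.2 == q'.1) && (q' \in E)
  else false.

Hypothesis arcE : forall x y, ((x, y) \in A) = gadget_arc (vk x) (vp x) (vk y) (vp y).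

Lemma mk_eq k k' q q' : k < 5 -> k' < 5 -> (mk k q == mk k' q') = (k == k') && (q == q').
Proof.
move=> lt_k lt_k'; apply/eqP/andP => [e|[/eqP-> /eqP->] //].
by rewrite -(vk_mk q lt_k) -{2}(vp_mk q lt_k) e vk_mk // vp_mk.
Qed.

Lemma arc_mk k k' q q' : k < 5 -> k' < 5 ->
  ((mk k q, mk k' q') \in A) = gadget_arc k q k' q'.
Proof. by move=> lt_k lt_k'; rewrite arcE !vk_mk // !vp_mk. Qed.

Variant arc_spec : 'I_N -> 'I_N -> Prop :=
| ArcSame k k' q of (k, k') \in same_pair_kinds : arc_spec (mk k q) (mk k' q)
| ArcIn q q' of q.2 = q'.2 & q \in E : arc_spec (mk 0 q) (mk 2 q')
| ArcOut q q' of q.2 = q'.1 & q' \in E : arc_spec (mk 2 q) (mk 4 q').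

Lemma arcP x y : (x, y) \in A -> arc_spec x y.
Proof.
rewrite arcE /gadget_arc -[X in arc_spec X]mkK -[X in arc_spec _ X]mkK.
case: ifP => [h /eqP->|_]; first exact: ArcSame.
case: eqP => [[-> ->] /andP [/eqP h1 h2]|_]; first exact: ArcIn.
by case: eqP => [[-> ->] /andP [/eqP h1 h2]|//]; apply: ArcOut.
Qed.

(** The kind increases along every arc. *)
Lemma gadget_acyclic : acyclic (arc_rel A).
Proof.
apply: (@acyclic_rank _ _ vk) => x y /arcP; case=> [k k' q|q q' _ _|q q' _ _].
- by rewrite !inE => /or3P [] /eqP [-> ->]; rewrite !vk_mk.
- by rewrite !vk_mk.
by rewrite !vk_mk.
Qed.

(** * From a feedback arc set to a partition *)

Section Forward.
Variables (F : {set 'I_n * 'I_n}) (K : nat).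
Hypothesis fasF : feedback_arc_set E F.
Hypothesis cardF : #|F| <= K.

(** The label is a representative of the block: [p_q] for [s_q], [p_q], [t_q], and [a_q] for [b_q]
    unless [q] lies in [F]. *)
Definition label (x : 'I_N) : 'I_N :=
  if vk x \in [:: 1; 2; 3] then mk 2 (vp x)
  else if (vk x == 4) && (vp x \notin F) then mk 0 (vp x) else x.

Lemma label_mk k q : k < 5 -> label (mk k q) =
  if k \in [:: 1; 2; 3] then mk 2 q
  else if (k == 4) && (q \notin F) then mk 0 q else mk k q.
Proof. by move=> lt_k; rewrite /label vk_mk // vp_mk. Qed.

Definition label_partition : {set {set 'I_N}} := preim_partition label setT.

Lemma label_block B :
  reflect (exists x, B = [set y | label x == label y]) (B \in label_partition).
Proof.
apply: (iffP imsetP) => [[x _ ->]|[x ->]]; exists x => //.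
  by apply/setP => y; rewrite !inE.
by apply/setP => y; rewrite !inE.
Qed.

(** A label is some [p_q], some [a_q], or a [b_q] with [q] in [F]. *)
Lemma card_label_partition : #|label_partition| <= 2 * (n * n) + K.
Proof.
have cardp : #|[set: 'I_n * 'I_n]| = n * n by rewrite cardsT card_prod card_ord.
have sub : label_partition \subset
    [set [set y | z == label y] | z in mk 2 @: [set: 'I_n * 'I_n]
       :|: mk 0 @: [set: 'I_n * 'I_n] :|: mk 4 @: F].
  apply/subsetP => B /label_block [x ->]; apply/imsetP; exists (label x) => //.
  rewrite /label; case: ifP => [_|k1]; first by rewrite !inE imset_f.
  case: ifP => [_|k2]; first by rewrite !inE [mk 0 _ \in mk 0 @: _]imset_f ?orbT.
  rewrite -[x]mkK; have := vk_lt x; move: k1 k2.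
  case: (vk x) => [|[|[|[|[|k]]]]] //=; first by rewrite !inE [mk 0 _ \in mk 0 @: _]imset_f ?orbT.
  by move=> _ /negbFE hF _; rewrite inE [_ \in mk 4 @: F]imset_f ?orbT.
apply: leq_trans (subset_leq_card sub) _.
apply: leq_trans (leq_imset_card _ _) _.
apply: leq_trans (leq_card_setU _ _) _; apply: leq_add; last first.
  exact: leq_trans (leq_imset_card _ _) cardF.
apply: leq_trans (leq_card_setU _ _) _.
by rewrite mul2n -addnn -{1 2}cardp; apply: leq_add; apply: leq_imset_card.
Qed.

(** The blocks are the paths [s -> p -> t], the arcs [a -> b] for pairs outside [F], and singletons
    [a] and [b] for pairs in [F]. *)
Lemma label_ham_path B : B \in label_partition -> has_ham_path A B.
Proof.
case/label_block => x ->; rewrite -[x]mkK.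
have lt_k := vk_lt x; move: (vk x) (vp x) lt_k => k q lt_k {x}.
have memE (s : seq 'I_N) : (forall k' q', k' < 5 ->
    (mk k' q' \in s) = (label (mk k q) == label (mk k' q'))) ->
    [set y in s] = [set y | label (mk k q) == label y].
  move=> h; apply/setP => y; rewrite !inE.
  by have := h (vk y) (vp y) (vk_lt y); rewrite mkK.
case kin : (k \in [:: 1; 2; 3]).
  exists [:: mk 1 q; mk 2 q; mk 3 q]; split=> //.
  - by rewrite /= !inE !mk_eq.
  - apply: memE => k' q' lt_k'; rewrite !label_mk // kin !inE !mk_eq //.
    case: k' lt_k' => [|[|[|[|[|k']]]]] //= _; rewrite ?(orbF, mk_eq) //=.
    by case: ifP => _; rewrite mk_eq.
  - by rewrite /= /arc_rel !arc_mk // /gadget_arc /= !eqxx.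
case qF : (q \in F).
  exists [:: mk k q]; split=> //; apply: memE => k' q' lt_k'.
  rewrite !label_mk // kin qF andbF inE mk_eq //.
  case: (k' =P k) => [->|ne] /=.
    rewrite kin; case: ifP => [/andP [/eqP -> qF']|_].
      by rewrite mk_eq //; case: eqP qF' => // ->; rewrite qF.
    by rewrite mk_eq // eqxx eq_sym.
  case: k k' lt_k lt_k' kin ne => [|[|[|[|[|k]]]]] // [|[|[|[|[|k']]]]] //= _ _ _ ne.
  all: try by rewrite mk_eq.
  case: ifP => qF'; rewrite mk_eq //=.
  by case: eqP qF' => // <-; rewrite qF.
exists [:: mk 0 q; mk 4 q]; split=> //.
- by rewrite /= !inE !mk_eq.
- apply: memE => k' q' lt_k'.
  have -> : label (mk k q) = mk 0 q.
    by rewrite label_mk // kin qF; case: k lt_k kin => [|[|[|[|[|k]]]]].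
  rewrite !inE label_mk // !mk_eq //.
  case: k' lt_k' => [|[|[|[|[|k']]]]] //= _; rewrite ?mk_eq //= ?orbF 1?eq_sym //.
  case: ifP => qF'; rewrite mk_eq //=.
  by case: eqP qF' => // <-; rewrite qF.
by rewrite /= /arc_rel !arc_mk // /gadget_arc /= !eqxx.
Qed.

Lemma label_quotient_acyclic : acyclic (quot_rel A label_partition).
Proof.
case: fasF => _ hF.
have acy : acyclic [rel u v | ((u, v) \in E) && ((u, v) \notin F)].
  move=> c; apply/negP => /and3P [c0 uc cc].
  have /hasP [_ /mapP [x xc ->]] : has (mem F) (cycle_arcs c).
    apply: hF; apply/and3P; split=> //; apply: sub_cycle cc => u v.
    by case/andP.
  by have /andP [_ /negP] := next_cycle cc xc.
have [rho hrho] := rank_acyclic acy.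
(* [big] exceeds every other rank; it is meant for the singletons [b_q], with [q] in [F]. *)
pose big := (\max_v rho v).*2 + 9.
(* The label [p_(w,v)] has rank [2 rho(v) + 2]. For a kept arc [(u, v)] the block has the odd rank
   [2 rho(u) + 3], which lies strictly between the ranks for [u] and for [v] as [rho(u) < rho(v)].
   Singletons [a_q] get 0. *)
pose rk z := if vk z == 4 then big
  else if vk z == 2 then (rho (vp z).2).*2 + 2
  else if vp z \in F then 0 else (rho (vp z).1).*2 + 3.
have rk_big z : vk z != 4 -> rk z < big.
  move=> /negbTE k4; rewrite /rk k4 /big.
  have h1 := leq_bigmax (F := rho) (vp z).1; have h2 := leq_bigmax (F := rho) (vp z).2.
  by case: ifP => _; [|case: ifP => _]; lia.
have key x y : (x, y) \in A -> label x != label y -> rk (label x) < rk (label y).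
  case/arcP => [k k' q|q q' e qE|q q' e qE].
  - rewrite !inE => /or3P [] /eqP [-> ->]; rewrite !label_mk //= ?eqxx //.
    case: ifP => _; rewrite ?eqxx // => _.
    by rewrite {2}/rk vk_mk // eqxx; apply: rk_big; rewrite vk_mk.
  - rewrite !label_mk //= => _; rewrite /rk !vk_mk //= !vp_mk //.
    case: ifP => qF; first by lia.
    have := hrho q.1 q.2; rewrite /= -surjective_pairing qE qF -e => /(_ isT).
    by move: (rho q.1) (rho q.2) => a b; lia.
  rewrite !label_mk //= => _; case: ifP => qF.
    by rewrite /rk !vk_mk //= !vp_mk // (negbTE qF) e ltn_add2l.
  by rewrite {2}/rk vk_mk // eqxx; apply: rk_big; rewrite vk_mk.
(* The label is constant on a block, so any element gives the rank of the block. *)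
pose f (B : {set 'I_N}) := if [pick x in B] is Some x then rk (label x) else 0.
have fE (B : {set 'I_N}) x : B \in label_partition -> x \in B -> f B = rk (label x).
  case/label_block => x0 ->; rewrite inE => /eqP <-; rewrite /f.
  case: pickP => [y|/(_ x0)]; rewrite inE ?eqxx //.
  by move/eqP ->.
apply: (@acyclic_rank _ _ f) => B C /and4P [hB hC ne].
case/existsP => x /andP [xB] /existsP [y] /andP [yC xyA].
rewrite (fE B x) // (fE C y) //; apply: key => //.
apply: contra ne; case/label_block: hB xB => x0 ->; rewrite inE => /eqP ->.
case/label_block: hC yC => y0 ->; rewrite inE => /eqP -> /eqP ->.
by apply/eqP/setP => z; rewrite !inE.
Qed.

Lemma label_Hstar : Hstar_partition A label_partition.
Proof.
split; [exact: preim_partitionP | exact: label_ham_path | exact: label_quotient_acyclic].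
Qed.

End Forward.

(** * From a partition to a feedback arc set *)

Section Backward.
Variables (P : {set {set 'I_N}}) (K : nat).
Hypothesis hP : Hstar_partition A P.
Hypothesis cardP : #|P| <= 2 * (n * n) + K.

Definition arc_block (q : 'I_n * 'I_n) : {set 'I_N} := [set mk 0 q; mk 4 q].

(** A block with some [p] has at most three vertices; one without is a singleton or an [arc_block].
    Summed over the blocks, the weight 2 turns into [2n^2], as there are [n^2] vertices [p]. *)
Lemma ham_block_card B : has_ham_path A B ->
  #|B| <= 1 + 2 * #|[set x in B | vk x == 2]| + (B \in arc_block @: setT).
Proof.
case=> s [s0 us <- ss].
have -> : #|[set x in s]| = size s by rewrite cardsE; apply/card_uniqP.
case hs : (has (fun x => vk x == 2) s).
  have h1 : 0 < #|[set x in [set x in s] | vk x == 2]|.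
    by case/hasP: hs => x xs kx; rewrite card_gt0; apply/set0Pn; exists x; rewrite !inE xs.
  suff h2 : size s <= 3.
    apply: leq_trans (leq_addr _ _); apply: leq_trans h2 _.
    by rewrite -[3]/(1 + 2 * 1) leq_add2l leq_pmul2l.
  (* [lev] is 0 on [a] and [s], 1 on [p], 2 on [t] and [b]. It increases along every arc, which
     limits a path to three vertices. *)
  pose lev x := (1 < vk x) + (2 < vk x).
  have ssl : sorted ltn (map lev s).
    rewrite sorted_map; apply: sub_sorted ss => x y /arcP.
    rewrite /lev /=; case=> [k k' q|q q' _ _|q q' _ _]; last 2 first.
    - by rewrite !vk_mk.
    - by rewrite !vk_mk.
    by rewrite !inE => /or3P [] /eqP [-> ->]; rewrite !vk_mk.
  rewrite -(size_map lev) -[3](size_iota 0); apply: uniq_leq_size.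
    exact: sorted_uniq ltn_trans ltnn _ ssl.
  by move=> _ /mapP [x _ ->]; rewrite mem_iota /lev; do 2 case: (_ < vk x).
(* Without a [p], the first arc can only be [a_q -> b_q], and the path ends there because no arc
   leaves a [b]. *)
case: s s0 us ss hs => [|x [|y s]] // _ us.
case/andP => xy ys /negbT /norP [kx /norP [ky _]].
case/arcP: xy us ys kx ky => [k k' q hk|q q' _ _|q q' _ _] us ys; last 2 first.
- by rewrite [vk (mk 2 _)]vk_mk.
- by rewrite [vk (mk 2 _)]vk_mk.
move: hk us ys; rewrite !inE => /or3P [] /eqP [-> ->] us ys; rewrite !vk_mk // => _ _.
case: s us ys => [|z s] us /= => [_|/andP [/arcP h _]].
  suff -> : [set x in [:: mk 0 q; mk 4 q]] \in arc_block @: setT by lia.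
  by apply/imsetP; exists q => //; apply/setP => z; rewrite !inE.
have : vk (mk 4 q) < 4.
  case: h => [k1 k2 q1|q1 q2 _ _|q1 q2 _ _]; [|by rewrite vk_mk|by rewrite vk_mk].
  by rewrite !inE => /or3P [] /eqP [-> _]; rewrite vk_mk.
by rewrite vk_mk.
Qed.

Lemma card_missing_blocks : #|[set q | arc_block q \notin P]| <= K.
Proof.
case: hP => partP hamP _.
have h1 : 5 * (n * n) = \sum_(B in P) #|B|.
  by rewrite -(card_partition partP) cardsT card_ord.
have h2 : \sum_(B in P) #|B| <= \sum_(B in P)
    (1 + 2 * #|[set x in B | vk x == 2]| + (B \in arc_block @: setT)).
  by apply: leq_sum => B BP; apply: ham_block_card; apply: hamP.
have h3 : \sum_(B in P) #|[set x in B | vk x == 2]| <= n * n.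
  have -> : \sum_(B in P) #|[set x in B | vk x == 2]| = \sum_(x in setT) (vk x == 2).
    rewrite (set_partition_big _ partP) /=; apply: eq_bigr => B _.
    by rewrite -sum1dep_card big_mkcondr.
  have <- : #|[set: 'I_n * 'I_n]| = n * n by rewrite cardsT card_prod card_ord.
  apply: leq_trans (leq_imset_card (mk 2) _).
  have <- : #|[set x | vk x == 2]| = \sum_(x in setT) (vk x == 2).
    rewrite -sum1_card big_mkcond [RHS]big_mkcond.
    by apply: eq_bigr => x _; rewrite !inE; case: eqP.
  apply: subset_leq_card; apply/subsetP => x; rewrite !inE => /eqP kx.
  by apply/imsetP; exists (vp x) => //; rewrite -{1}kx mkK.
have h4 : \sum_(B in P) (B \in arc_block @: setT) <= #|[set q | arc_block q \in P]|.
  apply: leq_trans (leq_imset_card arc_block _).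
  rewrite -big_mkcondr sum1dep_card; apply: subset_leq_card.
  apply/subsetP => B; rewrite inE => /andP [BP /imsetP [q _ e]].
  by apply/imsetP; exists q => //; rewrite inE -e.
have h5 : #|[set q | arc_block q \in P]| + #|[set q | arc_block q \notin P]| = n * n.
  have <- : #|[set: 'I_n * 'I_n]| = n * n by rewrite cardsT card_prod card_ord.
  rewrite -(cardsID [set q | arc_block q \in P] setT) setTI; congr (_ + _).
  by apply: eq_card => q; rewrite !inE andbT.
move: h2; rewrite big_split /= big_split /= sum1_card -big_distrr /= -h1 => h2.
(* With [m = n^2] and [c] blocks [arc_block q] in [P]: [3m <= |P| + c] and [|P| <= 2m + K] give
   [m - c <= K]. *)
have arith p s3 s4 c d m : 5 * m <= p + 2 * s3 + s4 -> s3 <= m -> s4 <= c -> c + d = m ->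
  p <= 2 * m + K -> d <= K by lia.
exact: arith h2 h3 h4 h5 cardP.
Qed.

Lemma backward_fas : feedback_arc_set E [set q in E | arc_block q \notin P].
Proof.
case: hP => partP _ /rank_acyclic [f hf]; split.
  by apply/subsetP => q; rewrite inE => /andP [].
(* The block of [p_(u,u)] stands for the vertex [u]; any fixed [p_(w,u)] would serve. *)
pose pb u := pblock P (mk 2 (u, u)).
have pb_in u : mk 2 (u, u) \in pb u.
  by rewrite mem_pblock (cover_partition partP).
have pb_mem u : pb u \in P by apply: pblock_mem; rewrite (cover_partition partP).
have pb_neq u q : pb u != arc_block q.
  by apply/eqP => e; have := pb_in u; rewrite e !inE !mk_eq.
have acy : acyclic [rel u v | ((u, v) \in E) && (arc_block (u, v) \in P)].
  apply: (@acyclic_rank _ _ (fun u => f (pb u))) => u v /= /andP [uvE uvP].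
  (* A kept arc gives two quotient arcs: from the block of [p_(u,u)] to the arc block by
     [p_(u,u) -> b_(u,v)], and on to the block of [p_(v,v)] by [a_(u,v) -> p_(v,v)]. *)
  apply: (@ltn_trans (f (arc_block (u, v)))); apply: hf; apply/and4P; split=> //.
  - apply/existsP; exists (mk 2 (u, u)); rewrite pb_in; apply/existsP; exists (mk 4 (u, v)).
    by rewrite set22 arc_mk // /gadget_arc /= eqxx uvE.
  - by rewrite eq_sym.
  apply/existsP; exists (mk 0 (u, v)); rewrite set21; apply/existsP; exists (mk 2 (v, v)).
  by rewrite pb_in arc_mk // /gadget_arc /= eqxx uvE.
(* A cycle avoiding the set would consist of kept arcs only. *)
move=> c /and3P [c0 uc cc]; apply: contraT => /hasPn h.
have /negP[] := acy c; apply/and3P; split=> //.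
apply: (@sub_in_cycle _ (mem c) (frel (next c))); last exact: cycle_next.
  move=> x y xc _ /= /eqP <-; have xE := next_cycle cc xc.
  have := h (x, next c x) (map_f _ xc); rewrite /= inE.
  by rewrite [_ \in E]xE /= negbK.
by apply/allP.
Qed.

End Backward.

Lemma gadget_correct K :
  (exists F, feedback_arc_set E F /\ #|F| <= K) <->
  (exists P, Hstar_partition A P /\ #|P| <= 2 * (n * n) + K).
Proof.
split=> [[F [fasF cF]]|[P [hP cP]]].
  by exists (label_partition F); split; [apply: label_Hstar | apply: card_label_partition].
exists [set q in E | arc_block q \notin P]; split; first exact: backward_fas.
apply: leq_trans (card_missing_blocks hP cP); apply: subset_leq_card.
by apply/subsetP => q; rewrite !inE => /andP [].
Qed.

End Gadget.

(** * The reduction *)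

(** Splitting an index into quotient and remainder by [k] turns one enumeration into two nested
    loops. *)
Lemma flatten_iota_mul (T : Type) (g : nat -> seq T) m k :
  flatten [seq g a | a <- iota 0 (m * k)] =
  flatten [seq flatten [seq g (i * k + j) | j <- iota 0 k] | i <- iota 0 m].
Proof.
elim: m => [|m IHm] //; rewrite mulSn addnC iotaD map_cat flatten_cat IHm.
rewrite -[m.+1]addn1 iotaD map_cat flatten_cat /= cats0 !add0n.
by congr (_ ++ flatten _); rewrite -{1}[m * k]addn0 iotaDl -map_comp.
Qed.

Lemma enum_pairs_iota (N : nat) (A : 'I_N -> 'I_N -> bool) (phi : nat -> nat -> bool) :
  (forall x y : 'I_N, A x y = phi x y) ->
  [seq A x y | x <- enum 'I_N, y <- enum 'I_N] =
  flatten [seq flatten [seq [:: phi a b] | b <- iota 0 N] | a <- iota 0 N].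
Proof.
move=> h; rewrite -val_enum_ord -map_comp; congr flatten; apply: eq_map => x /=.
rewrite -map_comp; set s := enum _; elim: s => //= y s ->.
by rewrite h.
Qed.

(** * The encoded input, cell by cell *)

Section InputFacts.
Variables (n K : nat) (E : {set 'I_n * 'I_n}).

Definition nat_arc (i j : nat) : bool :=
  [exists q in E, (q.1 == i :> nat) && (q.2 == j :> nat)].

Lemma nat_arcE (i j : 'I_n) : nat_arc i j = ((i, j) \in E).
Proof.
apply/existsP/idP => [[[i' j'] /and3P [/= qE /eqP/val_inj <- /eqP/val_inj <-]] //|ijE].
by exists (i, j); rewrite ijE !eqxx.
Qed.

Let x := encode (Inst E K).
Let M := [seq (u, v) \in E | u <- enum 'I_n, v <- enum 'I_n].

Lemma onth_arc i j : i < n -> j < n -> onth M (i * n + j) = Some (nat_arc i j).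
Proof.
move=> lt_i lt_j.
have -> : M = [seq nat_arc (c %/ n) (c %% n) | c <- iota 0 (n * n)].
  rewrite -[RHS]flatten_seq1 -map_comp flatten_iota_mul /M.
  rewrite (@enum_pairs_iota _ _ nat_arc); last by move=> u v; rewrite nat_arcE.
  congr flatten; apply/eq_in_map => u; rewrite mem_iota => /= lt_u.
  congr flatten; apply/eq_in_map => v; rewrite mem_iota => /= lt_v.
  by rewrite divnMDl ?modnMDl ?modn_small ?divn_small ?addn0 //; lia.
have lt_c : i * n + j < n * n by nia.
rewrite onthE -map_comp (nth_map 0) ?size_iota // nth_iota //= add0n.
by rewrite divnMDl ?modnMDl ?modn_small ?divn_small ?addn0 //; lia.
Qed.

Lemma size_arc_bits : size M = n * n.
Proof. by rewrite size_allpairs size_enum_ord. Qed.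

Lemma encode_ones i : i < n -> onth x i = Some true.
Proof. by move=> lt_i; rewrite /x /encode onth_cat size_nseq /= lt_i onth_nseq lt_i. Qed.

Lemma encode_sep : onth x n = Some false.
Proof. by rewrite /x /encode onth_cat size_nseq /= ltnn subnn. Qed.

Lemma encode_tail k : onth x (n.+1 + k) = onth (M ++ nseq K true) k.
Proof.
rewrite /x /encode onth_cat size_nseq /=.
have -> : (n.+1 + k < n) = false by lia.
by have -> : n.+1 + k - n = k.+1 by lia.
Qed.

Lemma encode_arc i j : i < n -> j < n -> input_arc x n i j = nat_arc i j.
Proof.
move=> lt_i lt_j; rewrite /input_arc encode_tail onth_cat size_arc_bits.
have -> : i * n + j < n * n by nia.
by rewrite onth_arc //; case: nat_arc.
Qed.

Lemma encode_K k : onth x (n.+1 + n * n + k) = if k < K then Some true else None.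
Proof.
rewrite -addnA encode_tail onth_cat size_arc_bits.
have -> : (n * n + k < n * n) = false by lia.
by have -> : n * n + k - n * n = k by [lia]; rewrite onth_nseq.
Qed.

End InputFacts.

(** * The target instance and its vertex numbering *)

Section Target.
Variables (n K : nat) (E : {set 'I_n * 'I_n}).

Local Notation N := (5 * (n * n)).

(** The mere existence of a vertex makes [n] positive, as the divisions below require. *)
Lemma vertex_gt0 (x : 'I_N) : 0 < n.
Proof. by case: x => m; case: (n). Qed.

Definition vkind (x : 'I_N) : nat := x %/ (n * n).

Lemma vrow_lt (x : 'I_N) : x %% (n * n) %/ n < n.
Proof.
have n0 := vertex_gt0 x.
by rewrite ltn_divLR // ltn_pmod // muln_gt0 n0.
Qed.

Lemma vcol_lt (x : 'I_N) : x %% n < n.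
Proof. by rewrite ltn_pmod // (vertex_gt0 x). Qed.

Definition vpair (x : 'I_N) : 'I_n * 'I_n := (Ordinal (vrow_lt x), Ordinal (vcol_lt x)).

(** The reduction [k %% 5] keeps the number in range for every [k], which makes [mkv] total. *)
Lemma mkv_lt k (q : 'I_n * 'I_n) : k %% 5 * (n * n) + (q.1 * n + q.2) < N.
Proof.
have h1 : q.1 * n + q.2 < n * n by have := ltn_ord q.1; have := ltn_ord q.2; nia.
have h2 : k %% 5 < 5 by rewrite ltn_pmod.
by nia.
Qed.

Definition mkv (k : nat) (q : 'I_n * 'I_n) : 'I_N := Ordinal (mkv_lt k q).

Lemma decode_kind k i j : i < n -> j < n -> (k * (n * n) + (i * n + j)) %/ (n * n) = k.
Proof.
move=> lt_i lt_j; have h : i * n + j < n * n by nia.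
by rewrite divnMDl ?divn_small ?addn0 //; nia.
Qed.

Lemma decode_row k i j : i < n -> j < n -> (k * (n * n) + (i * n + j)) %% (n * n) %/ n = i.
Proof.
move=> lt_i lt_j; have h : i * n + j < n * n by nia.
by rewrite modnMDl modn_small // divnMDl ?divn_small ?addn0 //; lia.
Qed.

Lemma decode_col k i j : j < n -> (k * (n * n) + (i * n + j)) %% n = j.
Proof. by move=> lt_j; rewrite mulnA modnMDl modnMDl modn_small. Qed.

Definition target_arcs : {set 'I_N * 'I_N} :=
  [set xy | gadget_arc E (vkind xy.1) (vpair xy.1) (vkind xy.2) (vpair xy.2)].

Definition target : instance := Inst target_arcs (2 * (n * n) + K).

Lemma vkind_lt x : vkind x < 5.
Proof.
by have n0 := vertex_gt0 x; rewrite /vkind ltn_divLR ?muln_gt0 ?n0.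
Qed.

Lemma mkvK x : mkv (vkind x) (vpair x) = x.
Proof.
apply: val_inj => /=; rewrite (modn_small (vkind_lt x)) /vkind.
have -> : x %% n = x %% (n * n) %% n by rewrite modn_dvdm // dvdn_mulr.
by rewrite -divn_eq -divn_eq.
Qed.

Lemma vkind_mkv k q : k < 5 -> vkind (mkv k q) = k.
Proof. by move=> lt_k; rewrite /vkind /= modn_small // decode_kind. Qed.

Lemma vpair_mkv k q : k < 5 -> vpair (mkv k q) = q.
Proof.
case: q => i j lt_k; rewrite /vpair; congr (_, _); apply: val_inj => /=.
  by rewrite decode_row.
by rewrite decode_col.
Qed.

Lemma gadget_arcE k (q : 'I_n * 'I_n) k' (q' : 'I_n * 'I_n) :
  gadget_arc E k q k' q' = gadget_bit (nat_arc E) k q.1 q.2 k' q'.1 q'.2.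
Proof.
rewrite /gadget_arc /gadget_bit !nat_arcE -!surjective_pairing.
by case: q q' => i j [i' j'].
Qed.

(** Kind, row and column are the digits of a vertex number, so the six nested loops of the program
    run through the matrix in order. *)
Lemma target_matrix :
  [seq (x, y) \in target_arcs | x <- enum 'I_N, y <- enum 'I_N] =
  matrix_bits (encode (Inst E K)) n.
Proof.
pose phi (a b : nat) := gadget_bit (nat_arc E)
  (a %/ (n * n)) (a %% (n * n) %/ n) (a %% n) (b %/ (n * n)) (b %% (n * n) %/ n) (b %% n).
rewrite (@enum_pairs_iota _ _ phi); last by move=> x y; rewrite inE /= gadget_arcE.
rewrite /matrix_bits /pair_out flatten_iota_mul.
congr flatten; apply: eq_map => k; rewrite flatten_iota_mul.
congr flatten; apply/eq_in_map => i; rewrite mem_iota add0n => /andP [_ lt_i].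
congr flatten; apply/eq_in_map => j; rewrite mem_iota add0n => /andP [_ lt_j].
rewrite flatten_iota_mul.
congr flatten; apply: eq_map => k'; rewrite flatten_iota_mul.
congr flatten; apply/eq_in_map => i'; rewrite mem_iota add0n => /andP [_ lt_i'].
congr flatten; apply/eq_in_map => j'; rewrite mem_iota add0n => /andP [_ lt_j'].
rewrite /phi !decode_kind // !decode_row // !decode_col // /gadget_bit.
by rewrite !encode_arc.
Qed.

Lemma target_correct : FAS_yes (Inst E K) <-> AHP_yes target.
Proof.
apply: (gadget_correct (mk := mkv) (vk := vkind) (vp := vpair)) => //.
- exact: vkind_lt.
- exact: mkvK.
- exact: vkind_mkv.
- exact: vpair_mkv.
by move=> x y; rewrite inE.
Qed.

Lemma target_valid : 0 < K <= n -> AHP_instance target.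
Proof.
(* [0 < K <= n] gives [2n^2 + K <= 5n^2]. *)
move=> /andP [K0 Kn]; split; last by rewrite /=; nia.
apply: (gadget_acyclic (E := E) (mk := mkv) (vk := vkind) (vp := vpair)) => //.
- exact: mkvK.
- exact: vkind_mkv.
by move=> x y; rewrite inE.
Qed.

End Target.

Definition reduction_frag : frag := seqn fragInit (seqn reduction_program fragFinal).

Lemma reduction_frag_computes n K (E : {set 'I_n * 'I_n}) T :
  let m := reduction_cost n K in
  1 + (m * (2 * m + 3) + (2 * m + 1)) <= T ->
  computes_within (tm_of reduction_frag) (encode (Inst E K)) (encode (target K E)) T.
Proof.
move=> m le_T; set x := encode (Inst E K).
have xK k : k < K -> onth x (n.+1 + n * n + k) = Some true by rewrite encode_K => ->.
have xE : onth x (n.+1 + n * n + K) = None by rewrite encode_K ltnn.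
have [b [s [r hs]]] := @triple_reduction_program x n (@encode_ones n K E)
  (@encode_sep n K E) K xK xE start_store erefl.
(* The start store is bounded by 0, so the program keeps pointers and output size within [m]; this
   also bounds the final sweep. *)
have [[_ bo] e] := r 0 (conj (fun _ _ => leqnn 0) (leqnn 0)).
rewrite !add0n -/m in bo e.
have es : out s = encode (target K E) by rewrite hs -(target_matrix K E).
have pos : 0 < size (out s) by rewrite hs size_cat /= addnS.
rewrite -es; apply: (@frag_computes _ _ _ _ true (final_tape x s 0)).
  apply: freach_weaken (exec_branch (exec_init x) (exec_branch e _)); last first.
    by case: b {r e}; apply: exec_final.
  by apply: leq_trans le_T; rewrite !leq_add2l leq_add2r leq_mul2l.
by move=> i le_i; rewrite /final_tape ltn0 le_i.
Qed.

(** * Polynomial bound on the running time *)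

Definition poly_bounded (f : instance -> nat) : Prop :=
  exists c d, forall I, f I <= c * (size (encode I)).+1 ^ d.

Lemma poly_bounded_cst k : poly_bounded (fun=> k).
Proof. by exists k, 0 => I; rewrite muln1. Qed.

(** The base [(size (encode I)).+1] is positive, so either exponent may be raised to [d + d']. *)
Lemma poly_bounded_add f g :
  poly_bounded f -> poly_bounded g -> poly_bounded (fun I => f I + g I).
Proof.
move=> [c [d hf]] [c' [d' hg]]; exists (c + c'), (d + d') => I.
rewrite mulnDl; apply: leq_add.
  apply: leq_trans (hf I) _; rewrite leq_mul2l leq_pexp2l ?orbT //; exact: leq_addr.
apply: leq_trans (hg I) _; rewrite leq_mul2l leq_pexp2l ?orbT //; exact: leq_addl.
Qed.

Lemma poly_bounded_mul f g :
  poly_bounded f -> poly_bounded g -> poly_bounded (fun I => f I * g I).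
Proof.
move=> [c [d hf]] [c' [d' hg]]; exists (c * c'), (d + d') => I.
by rewrite expnD mulnACA; apply: leq_mul.
Qed.

(** [encode] writes [n] in unary. *)
Lemma poly_bounded_n : poly_bounded inst_n.
Proof.
exists 1, 1 => I; rewrite mul1n expn1 /encode size_cat size_nseq.
exact: leqW (leq_addr _ _).
Qed.

Lemma poly_bounded_K : poly_bounded inst_K.
Proof.
exists 1, 1 => I; rewrite mul1n expn1 /encode !size_cat /= size_cat !size_nseq; lia.
Qed.

Lemma poly_bounded_succ f : poly_bounded f -> poly_bounded (fun I => (f I).+1).
Proof. exact: (poly_bounded_add (poly_bounded_cst 1)). Qed.

Ltac poly_bounded_tac := repeat match goal with
  | |- poly_bounded (fun I => @?f I + @?g I) => apply: (@poly_bounded_add f g)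
  | |- poly_bounded (fun I => @?f I * @?g I) => apply: (@poly_bounded_mul f g)
  | |- poly_bounded (fun=> ?k) => exact: (poly_bounded_cst k)
  | |- poly_bounded (fun I => (@?f I).+1) => apply: (@poly_bounded_succ f)
  | |- poly_bounded (fun I => inst_n I) => exact: poly_bounded_n
  | |- poly_bounded (fun I => inst_K I) => exact: poly_bounded_K
  end.

Lemma poly_bounded_pair_cost f :
  poly_bounded f -> poly_bounded (fun I => pair_cost (inst_n I) (f I)).
Proof. by move=> hf; rewrite /pair_cost; poly_bounded_tac. Qed.

Lemma poly_bounded_reduction_cost :
  poly_bounded (fun I => reduction_cost (inst_n I) (inst_K I)).
Proof.
by rewrite /reduction_cost; poly_bounded_tac; do ?apply: poly_bounded_pair_cost;
  poly_bounded_tac; apply: poly_bounded_pair_cost; poly_bounded_tac.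
Qed.

Lemma poly_bounded_reduction_time :
  poly_bounded (fun I => let m := reduction_cost (inst_n I) (inst_K I) in
    1 + (m * (2 * m + 3) + (2 * m + 1))).
Proof. by have hm := poly_bounded_reduction_cost; cbv zeta; poly_bounded_tac. Qed.

Theorem theorem5p10 : poly_reducible FAS_instance FAS_yes AHP_instance AHP_yes.
Proof.
have [c [d hT]] := poly_bounded_reduction_time.
exists (tm_of reduction_frag), c, d => -[n E K] hI; exists (target K E); split.
- exact: target_valid.
- have := hT (Inst E K); move: (c * _) => T leT; exact: reduction_frag_computes leT.
exact: target_correct.
Qed.
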